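(* Work in the polyhedral setting and with the constants $\bar\epsilon,\hat\epsilon>0$ described in the context. Consider one cycle of the algorithm with input $y^\circ\in X^m$, and suppose that $\|x_0^+\|\le\min(\hat\epsilon,\sqrt{2\bar\epsilon})$ and $\delta^*(y_i^\circ,C_i)=0$ for all $i\in[1,m]$. Suppose further that for all $i\in[1,m]$ the polyhedron $P_{i,j}$ (whenever it is defined, i.e. $i\in Q_j$) is the intersection of halfspaces of the form $\mathcal H_{i,r}$ and halfspaces of the form $\{x:\langle e_{j',j'},x\rangle\le0\}$, where $j'<j$ is such that $s(j')=i$. Then there is a constant $\rho\in[0,1)$ such that $\|x_{w'}^+\|\le\rho\|x_0^+\|$.
   Context: $[a,b]$ denotes the integers from $a$ to $b$. $P_D$ is the projection onto a closed convex set $D$, and $\delta^*(z,D)=\sup_{x\in D}\langle z,x\rangle$. Polyhedral setting. $X$ is a real Hilbert space. For $i\in[1,m]$, $r\in[1,K]$ let $f_{i,r}\in X$ be unit vectors, $c_{i,r}\in\mathbb R\cup\{\infty\}$, $\mathcal H_{i,r}=\{x:\langle x,f_{i,r}\rangle\le c_{i,r}\}$, $H_{i,r}=\{x:\langle x,f_{i,r}\rangle=c_{i,r}\}$ (so $\mathcal H_{i,r}=X$, $H_{i,r}=\emptyset$ if $c_{i,r}=\infty$), $C_i=\bigcap_{r=1}^K\mathcal H_{i,r}$, $C=\bigcap_{i=1}^m C_i\ne\emptyset$. Let $d\in X$ with $P_C(d)=0$. Let $I=\{i\in[1,m]:0\in\mathrm{int}\,C_i\}$. For $i\notin I$, the halfspaces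 $\mathcal H_{i,r}$ with $0\in H_{i,r}$ are exactly those with $r\in[1,K']$. Let $C_i'$ be the intersection of the $\mathcal H_{i,r}$ with $0\in H_{i,r}$ (so $C_i'=\bigcap_{r=1}^{K'}\mathcal H_{i,r}$ for $i\notin I$ and $C_i'=X$ for $i\in I$). Dual function: $v(y)=\frac12\|d-\sum_{i=1}^m y_i\|^2+\sum_{i=1}^m\delta^*(y_i,C_i)$ for $y\in X^m$. One cycle of the algorithm (a run). Input $y^\circ\in X^m$, output $y^+\in X^m$. Choose an integer $w'\ge m$ and $s:[1-m,w']\to[1,m]$ with $s(i-m)=i$ for $i\in[1,m]$ and $\{s(1),\dots,s(w')\}=[1,m]$. For $j\in[0,w']$, $i\in[1,m]$ put $\pi(j,i)=\max\{j'\le j:s(j')=i\}$, and for $j\in[1,w']$ put $p(j)=\pi(j-1,s(j))$. Set $e_{i-m,1}=y_i^\circ$ and $x_0^+=d-\sum_i y_i^\circ$. For $j=1,\dots,w'$: (a) $z_j=x_{j-1}^++e_{p(j),j}$, $x_j^\circ=P_{C_{s(j)}}(z_j)$, $e_{j,j}=z_j-x_j^\circ$ (so $e_{j,j}$ is defined for $j\ge1$; note $\pi(j,s(j))=j$ and $\pi(j,i)=\pi(j-1,i)$ for $i\ne s(j)$). (b) (SHQP step) Choose any $Q_j\subset[1,m]$ (possibly empty) and, for $i\in Q_j$, polyhedra $P_{i,j}\supset C_i$ with $\delta^*(e_{\pi(j,i),j},P_{i,j})=\delta^*(e_{\pi(j,i),j},C_i)$. Put $e_{\pi(j,i),j+1}=e_{\pi(j,i),j}$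 for $i\notin Q_j$, and let $(e_{\pi(j,i),j+1})_{i\in Q_j}$ be a minimizer over $(\tilde y_i)_{i\in Q_j}$ of $\frac12\|d-\sum_{i\notin Q_j}e_{\pi(j,i),j}-\sum_{i\in Q_j}\tilde y_i\|^2+\sum_{i\in Q_j}\delta^*(\tilde y_i,P_{i,j})$. Put $x_j^+=d-\sum_{i=1}^m e_{\pi(j,i),j+1}$. Finally $y_i^+=e_{\pi(w',i),w'+1}$. Constants. $\bar\epsilon>0$ is a constant such that every run with $v(y^\circ)\le\bar\epsilon$ satisfies $P_{C_{s(j)}}(z_j)=P_{C'_{s(j)}}(z_j)$ and $\delta^*(e_{j,j},C_{s(j)})=0$ for all $j\in[1,w']$. $\hat\epsilon>0$ is a constant such that for all $\lambda_{i,r}\ge0$ ($i\notin I$, $r\in[1,K']$), if $x=d-\sum_{i\notin I}\sum_{r=1}^{K'}\lambda_{i,r}f_{i,r}$ has $\|x\|\le\hat\epsilon$, then $x$ and $d$ both lie in $\mathrm{span}\{f_{i,r}:\lambda_{i,r}>0\}$. *)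

(* Defs.v *)
From HB Require Import structures.
From mathcomp Require Export all_boot all_order all_algebra.
From mathcomp Require Export all_classical all_reals all_analysis.
Export Order.TTheory GRing.Theory Num.Theory.
Export numFieldNormedType.Exports.

#[export] Set Implicit Arguments.
#[export] Unset Strict Implicit.
#[export] Unset Printing Implicit Defensive.

Local Open Scope classical_set_scope.
Local Open Scope ring_scope.

(* Throughout, the real Hilbert space is a complete normed module [X] whose
   norm comes from an inner product [dot]: [dot x x = `|x| ^+ 2] is a
   hypothesis of the theorem. *)

(* [p] is the projection of [z] onto [D]; for [D] closed, convex and nonempty
   in a Hilbert space there is exactly one such [p]. *)
Definition is_proj (R : realType) (X : completeNormedModType R)
    (D : set X) (z p : X) : Prop :=
  D p /\ forall q, D q -> `|z - p| <= `|z - q|.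

Definition support_fun (R : realType) (X : completeNormedModType R)
    (dot : X -> X -> R) (z : X) (D : set X) : \bar R :=
  ereal_sup [set (dot z x)%:E | x in D].

Definition is_polyhedron (R : realType) (X : completeNormedModType R)
    (dot : X -> X -> R) (P : set X) : Prop :=
  exists (n : nat) (a : 'I_n -> X) (b : 'I_n -> R),
    P = [set x | forall k, dot x (a k) <= b k].

Definition in_span (R : realType) (X : completeNormedModType R) (J : finType)
    (A : set J) (g : J -> X) (x : X) : Prop :=
  exists a : J -> R, (forall k, ~ A k -> a k = 0) /\ x = \sum_k a k *: g k.

Section Polyhedral.
Variables (R : realType) (X : completeNormedModType R) (dot : X -> X -> R).
Variables (m K : nat) (f : 'I_m -> 'I_K -> X) (c : 'I_m -> 'I_K -> \bar R).

Definition halfspace (i : 'I_m) (r : 'I_K) : set X :=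
  [set x | ((dot x (f i r))%:E <= c i r)%E].

Definition hyperplane (i : 'I_m) (r : 'I_K) : set X :=
  [set x | (dot x (f i r))%:E = c i r].

Definition Cset (i : 'I_m) : set X := \bigcap_(r in [set: 'I_K]) halfspace i r.

Definition Cinter : set X := \bigcap_(i in [set: 'I_m]) Cset i.

Definition Iset : {set 'I_m} := [set i | `[< (Cset i)° 0 >]]%SET.

(* For i in [Iset] this is an intersection over no halfspace, hence the whole
   space. *)
Definition Cset' (i : 'I_m) : set X :=
  \bigcap_(r in [set r | hyperplane i r 0]) halfspace i r.

End Polyhedral.

Section Cycle.
Variables (R : realType) (X : completeNormedModType R) (dot : X -> X -> R).
Variables (m : nat) (C : 'I_m -> set X) (d : X).

Definition dualv (y : 'I_m -> X) : \bar R :=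
  ((2^-1 * `|d - \sum_i y i| ^+ 2)%:E + \sum_i support_fun dot (y i) (C i))%E.

(* The indices 1, ..., m of the sets are the elements of ['I_m]: [i : 'I_m]
   stands for the index [i.+1].  Visits range over the integer interval
   [1-m, w'], and the initial visit of [i : 'I_m] is [i.+1%:Z - m%:Z]. *)

(* pi(j, i), the largest j' in [1-m, j] such that [s j' = i]; the bound variable
   k below stands for j' = k + 1 - m.  The maximum is over a nonempty set as soon
   as the initial visits are as in [is_cycle]. *)
Definition last_visit (s : int -> 'I_m) (j : nat) (i : 'I_m) : int :=
  (\max_(k < (m + j)%N | s (k.+1%:Z - m%:Z)%R == i) k.+1)%N%:Z - m%:Z.

(* The data of one run: w', s, (e_{k,j}), (z_j), (xo_j), (x_j^+), (Q_j),
   (P_{i,j}) and y^+; [cyc_e k j] is e_{k,j}.  Values at indices that the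
   algorithm does not use are irrelevant. *)
Record cycle := Cycle {
  cyc_w : nat;
  cyc_s : int -> 'I_m;
  cyc_e : int -> nat -> X;
  cyc_z : nat -> X;
  cyc_xo : nat -> X;
  cyc_xp : nat -> X;
  cyc_Q : nat -> {set 'I_m};
  cyc_P : 'I_m -> nat -> set X;
  cyc_yp : 'I_m -> X }.

(* Objective of the SHQP subproblem: [yc] are the current dual vectors, [yt]
   the new ones; only the components of [yt] in [Q] matter. *)
Definition shqp_obj (Q : {set 'I_m}) (P : 'I_m -> set X)
    (yc yt : 'I_m -> X) : \bar R :=
  ((2^-1 * `|d - \sum_(i | i \notin Q) yc i - \sum_(i in Q) yt i| ^+ 2)%:E
   + \sum_(i in Q) support_fun dot (yt i) (P i))%E.

Definition dykstra_step (g : cycle) (j : nat) : Prop :=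
  let: Cycle _ s e z xo xp _ _ _ := g in
  [/\ z j = xp j.-1 + e (last_visit s j.-1 (s j)) j,
      is_proj (C (s j)) (z j) (xo j) &
      e j j = z j - xo j].

Definition shqp_step (g : cycle) (j : nat) : Prop :=
  let: Cycle _ s e _ _ xp Q P _ := g in
  let pi := last_visit s j in
  [/\ forall i, i \in Q j ->
        [/\ is_polyhedron dot (P i j), C i `<=` P i j &
            support_fun dot (e (pi i) j) (P i j) =
            support_fun dot (e (pi i) j) (C i)],
      forall i, i \notin Q j -> e (pi i) j.+1 = e (pi i) j,
      forall yt : 'I_m -> X,
        (shqp_obj (Q j) (P ^~ j) (fun i => e (pi i) j)
           (fun i => e (pi i) j.+1)
         <= shqp_obj (Q j) (P ^~ j) (fun i => e (pi i) j) yt)%E &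
      xp j = d - \sum_i e (pi i) j.+1].

Definition is_cycle (y0 : 'I_m -> X) (g : cycle) : Prop :=
  let: Cycle w s e _ _ xp _ _ yp := g in
  [/\ [/\ (m <= w)%N,
          forall i : 'I_m, s (i.+1%:Z - m%:Z) = i &
          forall i : 'I_m, exists j : nat, (1 <= j <= w)%N /\ s j = i],
      (forall i : 'I_m, e (i.+1%:Z - m%:Z) 1%N = y0 i)
        /\ xp 0%N = d - \sum_i y0 i,
      forall j : nat, (1 <= j <= w)%N -> dykstra_step g j /\ shqp_step g j &
      forall i, yp i = e (last_visit s w i) w.+1].

End Cycle.

Section Constants.
Variables (R : realType) (X : completeNormedModType R) (dot : X -> X -> R).
Variables (m K : nat) (f : 'I_m -> 'I_K -> X) (c : 'I_m -> 'I_K -> \bar R).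
Variable d : X.

(* [cyc_xo g j] is the projection of [cyc_z g j] onto [Cset] by definition of a
   cycle, so the first conjunct says that the two projections coincide. *)
Definition is_eps_bar (eps : R) : Prop :=
  0 < eps /\
  forall (y0 : 'I_m -> X) (g : cycle X m),
    is_cycle dot (Cset dot f c) d y0 g ->
    (dualv dot (Cset dot f c) d y0 <= eps%:E)%E ->
    forall j : nat, (1 <= j <= cyc_w g)%N ->
      is_proj (Cset' dot f c (cyc_s g j)) (cyc_z g j) (cyc_xo g j) /\
      support_fun dot (cyc_e g j j) (Cset dot f c (cyc_s g j)) = 0%E.

Definition is_eps_hat (K' : nat) (eps : R) : Prop :=
  0 < eps /\
  forall lam : 'I_m -> 'I_K -> R,
    (forall (i : 'I_m) (r : 'I_K),
       i \notin Iset dot f c -> (r < K')%N -> 0 <= lam i r) ->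
    let x := d - \sum_(i | i \notin Iset dot f c)
                   \sum_(r < K | (r < K')%N) lam i r *: f i r in
    let A : set ('I_m * 'I_K) :=
      [set ir : 'I_m * 'I_K |
         [/\ ir.1 \notin Iset dot f c, (ir.2 < K')%N & 0 < lam ir.1 ir.2]] in
    let g := fun ir : 'I_m * 'I_K => f ir.1 ir.2 in
    `|x| <= eps -> in_span A g x /\ in_span A g d.

End Constants.

(* Main.v *)
Require Import Defs.
From mathcomp Require Import ring lra.
Local Open Scope classical_set_scope.
Local Open Scope ring_scope.

(** Let [e^2] be the total decrease of the dual objective over a cycle.  Every
    dual vector is a nonnegative combination of normals [f_ir] whose constraints
    have been tight at some iterate of the cycle.  If all iterates stay within
    [O(e)] of [x_0], then the last iterate is almost orthogonal to the normals
    (with zero right-hand side) that carry its dual vectors; by the choice of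
    [eps_hat] it also lies in their span up to [O(e)], so its norm is [O(e)], and
    [`|x_w'| ^+ 2 <= C * (`|x_0| ^+ 2 - `|x_w'| ^+ 2)], which is the contraction.

    The iterates stay near [x_0] uniformly in the number of steps for the
    following reason.  By pigeonhole there is a scale [r = O(e)] such that no
    constraint has a defect at [x_0] between [r] and [M * r].  Let [x'] satisfy
    with equality all the constraints of defect at most [r]; a Hoffman bound puts
    it within [O(r)] of [x_0].  While the iterates remain within [O(r)] of [x_0],
    only these constraints can become tight, so the steps cannot increase the
    distance to [x'] beyond [O(r)], and the argument closes by induction. *)

(** * Inner products and systems of linear inequalities *)

Section InnerProduct.
Context (R : realType) (X : completeNormedModType R) (dot : {dot X for idfun}).
Hypothesis hdot : forall x : X, dot x x = `|x| ^+ 2.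
Implicit Types x y z h : X.

Lemma dotC x y : dot x y = dot y x.
Proof. by rewrite hermC /= expr0 mul1r. Qed.

Lemma dotDl x y z : dot (x + y) z = dot x z + dot y z.
Proof. by rewrite linearDl. Qed.

Lemma dotDr x y z : dot z (x + y) = dot z x + dot z y.
Proof. by rewrite linearDr. Qed.

Lemma dotBl x y z : dot (x - y) z = dot x z - dot y z.
Proof. by rewrite linearBl. Qed.

Lemma dotBr x y z : dot z (x - y) = dot z x - dot z y.
Proof. by rewrite linearBr. Qed.

Lemma dotNl x z : dot (- x) z = - dot x z.
Proof. by rewrite linearNl. Qed.

Lemma dotNr x z : dot z (- x) = - dot z x.
Proof. by rewrite linearNr. Qed.

Lemma dotZl (a : R) x z : dot (a *: x) z = a * dot x z.
Proof. by rewrite linearZl_LR. Qed.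

Lemma dotZr (a : R) x z : dot z (a *: x) = a * dot z x.
Proof. by rewrite linearZr. Qed.

Lemma dot0l x : dot 0 x = 0. Proof. exact: linear0l. Qed.

Lemma dot0r x : dot x 0 = 0. Proof. exact: linear0r. Qed.

Lemma dot_sumr I (r : seq I) (P : pred I) (F : I -> X) x :
  dot x (\sum_(i <- r | P i) F i) = \sum_(i <- r | P i) dot x (F i).
Proof. exact: (raddf_sum (dot x)). Qed.

Lemma dot_suml I (r : seq I) (P : pred I) (F : I -> X) x :
  dot (\sum_(i <- r | P i) F i) x = \sum_(i <- r | P i) dot (F i) x.
Proof. by rewrite dotC dot_sumr; apply: eq_bigr => i _; rewrite dotC. Qed.

Lemma normD2 x y : `|x + y| ^+ 2 = `|x| ^+ 2 + 2 * dot x y + `|y| ^+ 2.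
Proof. by rewrite -!hdot !(dotDl, dotDr) (dotC y x); ring. Qed.

Lemma normB2 x y : `|x - y| ^+ 2 = `|x| ^+ 2 - 2 * dot x y + `|y| ^+ 2.
Proof. by rewrite normD2 dotNr normrN; ring. Qed.

Lemma dot_le x y : dot x y <= `|x| * `|y|.
Proof.
have [->|xn0] := eqVneq x 0; first by rewrite dot0l normr0 mul0r.
have [->|yn0] := eqVneq y 0; first by rewrite dot0r normr0 mulr0.
have px : 0 < `|x| by rewrite normr_gt0.
have py : 0 < `|y| by rewrite normr_gt0.
have := sqr_ge0 `| `|y| *: x - `|x| *: y|.
rewrite normB2 !normrZ !normr_id dotZl dotZr => H.
have : 0 <= (2 * (`|x| * `|y|)) * (`|x| * `|y| - dot x y) by nra.
by rewrite pmulr_rge0 ?subr_ge0// !mulr_gt0.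
Qed.

Lemma dot_norm_le x y : `|dot x y| <= `|x| * `|y|.
Proof.
by rewrite ler_norml dot_le andbT lerNl -dotNl (le_trans (dot_le _ _))// normrN.
Qed.

Lemma dot_inj0 y : (forall h, dot y h <= 0) -> y = 0.
Proof.
move=> H; have := H y; rewrite hdot => H1; apply/normr0_eq0/eqP.
by rewrite -sqrf_eq0 eq_le H1 sqr_ge0.
Qed.

(* Bartl's algebraic induction, which avoids proving that finitely generated cones
   are closed. *)
Lemma farkas (J : eqType) (s : seq J) (g : J -> X) y : uniq s ->
  (forall h, (forall k, k \in s -> dot (g k) h <= 0) -> dot y h <= 0) ->
  exists a : J -> R, (forall k, 0 <= a k) /\ y = \sum_(k <- s) a k *: g k.
Proof.
elim: s g y => [|k0 s IH] g y /=.
  move=> _ H; exists (fun=> 0); split=> //; rewrite big_nil.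
  by apply: dot_inj0 => h; apply: H.
move=> /andP[k0s us] H.
(* If [g k0] is dispensable it gets weight 0. Otherwise some [h0] obeys the constraints of [s] and
   has [0 < dot y h0], which forces [0 < dot (g k0) h0]. *)
have [H1|] := pselect (forall h, (forall k, k \in s -> dot (g k) h <= 0) -> dot y h <= 0).
  have [a [a0 ya]] := IH g y us H1.
  exists (fun k => if k == k0 then 0 else a k); split.
    by move=> k; case: ifP.
  rewrite big_cons eqxx scale0r add0r {1}ya !big_seq; apply: eq_bigr => k ks.
  by case: eqP => // kk0; rewrite -kk0 ks in k0s.
move=> /existsNP[h0 /not_implyP[h0s /negP]]; rewrite -ltNge => yh0.
have gh0 : 0 < dot (g k0) h0.
  rewrite ltNge; apply/negP => gle; move: yh0; rewrite ltNge => /negP; apply.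
  by apply: H => k; rewrite inE => /orP[/eqP->//|/h0s].
set t := dot (g k0) h0 in gh0.
have tn : t != 0 by rewrite gt_eqF.
(* The vectors are projected along [g k0] onto the orthogonal complement of [h0]; [E] transfers this
   oblique projection to its adjoint acting on [h]. *)
have [|a [a0 ya]] := IH (fun k => g k - (dot (g k) h0 / t) *: g k0)
    (y - (dot y h0 / t) *: g k0) us.
  move=> h hs.
  have E z : dot (z - (dot z h0 / t) *: g k0) h = dot z (h - (dot (g k0) h / t) *: h0).
    by rewrite dotBl dotBr dotZl dotZr; field.
  rewrite E; apply: H => k; rewrite inE => /orP[/eqP->|ks].
    by rewrite dotBr dotZr -/t divfK// subrr.
  by rewrite -E; exact: hs.
(* The coefficient of [g k0] left over when the projections are undone; both parts of the numerator
   contribute with the right sign. *)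
pose b := (dot y h0 - \sum_(k <- s) a k * dot (g k) h0) / t.
exists (fun k => if k == k0 then b else a k); split.
  move=> k; case: ifP => // _; rewrite divr_ge0 ?(ltW gh0)// subr_ge0.
  apply: le_trans (ltW yh0); rewrite big_seq; apply: sumr_le0 => j js.
  by rewrite mulr_ge0_le0// h0s.
rewrite big_cons eqxx.
rewrite (_ : \sum_(j <- s) _ = \sum_(j <- s) a j *: g j); last first.
  rewrite !big_seq; apply: eq_bigr => k ks.
  by case: eqP => // kk0; rewrite -kk0 ks in k0s.
rewrite -[LHS](subrK ((dot y h0 / t) *: g k0)) ya.
under eq_bigr do rewrite scalerBr scalerA mulrA.
rewrite sumrB -scaler_suml -mulr_suml /b mulrBl scalerBl.
by rewrite addrC addrA addrAC.
Qed.

(** Gram-Schmidt without linear independence: [u], the part of [g k0] orthogonal to the earlier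
    vectors, corrects the residual [v] of [x]; if [u = 0], any coefficient works. *)
Lemma span_proj (J : eqType) (s : seq J) (g : J -> X) x : uniq s ->
  exists a : J -> R, forall k, k \in s ->
    dot (x - \sum_(j <- s) a j *: g j) (g k) = 0.
Proof.
elim: s x => [|k0 s IH] x /=; first by exists (fun=> 0).
move=> /andP[k0s us].
have [a Ha] := IH x us; have [b Hb] := IH (g k0) us.
set u := g k0 - _ in Hb; set v := x - _ in Ha.
pose t := dot v u / dot u u.
exists (fun k => if k == k0 then t else a k - t * b k).
rewrite big_cons eqxx.
rewrite (_ : \sum_(j <- s) _ = \sum_(j <- s) (a j *: g j - t *: (b j *: g j))); last first.
  rewrite !big_seq; apply: eq_bigr => k ks.
  by case: eqP => [kk0|_]; [rewrite -kk0 ks in k0s|rewrite scalerBl scalerA].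
rewrite sumrB -scaler_sumr.
rewrite (_ : x - _ = v - t *: u); last first.
  by rewrite /v /u scalerBr !opprD !opprK (addrCA (- _)) !addrA.
have Hs k : k \in s -> dot (v - t *: u) (g k) = 0.
  by move=> ks; rewrite dotBl dotZl Ha// Hb// mulr0 subrr.
move=> k; rewrite inE => /orP[/eqP->|]; last exact: Hs.
have -> : g k0 = u + \sum_(j <- s) b j *: g j by rewrite /u subrK.
rewrite dotDr [X in _ + X]dot_sumr [X in _ + X]big_seq big1 ?addr0; last first.
  by move=> j js; rewrite dotZr Hs// mulr0.
rewrite dotBl dotZl /t.
have [u0|un0] := eqVneq u 0; first by rewrite u0 !dot0r mulr0 subrr.
by rewrite divfK ?subrr// hdot sqrf_eq0 normr_eq0.
Qed.

(* A Hoffman bound for affine equations; when the equations are inconsistent it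
   holds vacuously, because [C * t <= 1] then excludes small residuals. *)
Lemma eq_error_bound (J : eqType) (s : seq J) (g : J -> X) (c : J -> R) : uniq s ->
  exists2 C : R, 0 < C & forall x t, 0 <= t -> C * t <= 1 ->
    (forall k, k \in s -> `|dot x (g k) - c k| <= t) ->
    exists2 x', (forall k, k \in s -> dot x' (g k) = c k) & `|x - x'| <= C * t.
Proof.
elim: s => [|k0 s IH] /=.
  move=> _; exists 1 => // x t t0 _ _; exists x => //.
  by rewrite subrr normr0 mul1r.
move=> /andP[k0s us].
have [C C0 HC] := IH us; have [b Hb] := span_proj g (g k0) us.
(* When [u] vanishes, the other equations force the value [e] on [dot x' (g k0)], so the new
   equation is either redundant or contradictory. *)
set u := g k0 - _ in Hb.
have gE : g k0 = u + \sum_(j <- s) b j *: g j by rewrite /u subrK.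
set e := \sum_(j <- s) b j * c j.
have sE x' : (forall k, k \in s -> dot x' (g k) = c k) ->
    dot x' (g k0) = dot x' u + e.
  move=> Hx'; rewrite {1}gE dotDr dot_sumr; congr (_ + _).
  by rewrite /e !big_seq; apply: eq_bigr => j js; rewrite dotZr Hx'.
have g0 : 0 <= `|g k0| by [].
have near x x' t : `|dot x (g k0) - c k0| <= t -> `|x - x'| <= C * t ->
    `|c k0 - dot x' (g k0)| <= (1 + C * `|g k0|) * t.
  move=> xt xx'.
  have -> : c k0 - dot x' (g k0) = dot (x - x') (g k0) - (dot x (g k0) - c k0).
    by rewrite dotBl; ring.
  apply: le_trans (ler_normB _ _) _; rewrite mulrDl mul1r addrC lerD//.
  apply: le_trans (dot_norm_le _ _) _.
  by rewrite -mulrA (mulrC `|g k0|) mulrA ler_wpM2r.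
have [u0|un0] := eqVneq u 0.
  have [ce|cne] := eqVneq (c k0) e.
    exists C => // x t t0 Ct H.
    have [|x' Hx' xx'] := HC x t t0 Ct; first by move=> k ks; rewrite H// inE ks orbT.
    exists x' => // k; rewrite inE => /orP[/eqP->|]; last exact: Hx'.
    by rewrite sE// u0 dot0r add0r.
  (* Contradictory case: a residual [t] would satisfy [1 <= D * t], which the summand [2 * D] of the
     constant excludes. *)
  have k1 : 0 < `|c k0 - e| by rewrite normr_gt0 subr_eq0.
  pose D := (1 + C * `|g k0|) / `|c k0 - e|.
  have D0 : 0 < D by rewrite divr_gt0// ltr_wpDr// mulr_ge0// ltW.
  exists (C + 2 * D); first by rewrite addr_gt0// mulr_gt0.
  move=> x t t0 Ct H.
  have [||x' Hx' xx'] := HC x t t0.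
    by apply: le_trans Ct; rewrite ler_wpM2r// lerDl mulr_ge0// ltW.
    by move=> k ks; rewrite H// inE ks orbT.
  have := near x x' t (H _ (mem_head _ _)) xx'.
  rewrite sE// u0 dot0r add0r => H1.
  have : 1 <= D * t by rewrite /D mulrAC ler_pdivlMr// mul1r.
  have : 0 <= C * t by rewrite mulr_ge0// ltW.
  by nra.
have u0 : 0 < `|u| by rewrite normr_gt0.
pose D := (1 + C * `|g k0|) / `|u|.
have D0 : 0 < D by rewrite divr_gt0// ltr_wpDr// mulr_ge0// ltW.
exists (C + D); first by rewrite addr_gt0.
move=> x t t0 Ct H.
have [||x' Hx' xx'] := HC x t t0; first by apply: le_trans Ct; rewrite ler_wpM2r// lerDl ltW.
  by move=> k ks; rewrite H// inE ks orbT.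
(* Moving along [u] repairs the new equation and preserves the others, since [u] is orthogonal to
   their normals. *)
pose a := (c k0 - dot x' (g k0)) / `|u| ^+ 2.
have Hs k : k \in s -> dot (x' + a *: u) (g k) = c k.
  by move=> ks; rewrite dotDl dotZl Hb// mulr0 addr0 Hx'.
exists (x' + a *: u).
  move=> k; rewrite inE => /orP[/eqP->|]; last exact: Hs.
  rewrite sE// dotDl dotZl hdot addrAC -sE// /a divfK; first by rewrite addrC subrK.
  by rewrite sqrf_eq0 normr_eq0.
rewrite opprD addrA; apply: le_trans (ler_normB _ _) _.
rewrite mulrDl lerD// normrZ /a normrM normfV normrX normr_id expr2 invfM.
rewrite mulrA mulfVK ?normr_eq0// /D mulrAC ler_pM2r ?invr_gt0//.
exact: near (H _ (mem_head _ _)) xx'.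
Qed.

End InnerProduct.

(** The sum of finitely many admissible constants, plus 1, dominates each of them. It gives one
    constant for all constraints, or for all sets of constraints. *)
Lemma uniform_bound (R : realType) (T : finType) (P : T -> R -> Prop) :
  (forall t C D, 0 < C -> P t C -> C <= D -> P t D) ->
  (forall t, exists2 C, 0 < C & P t C) ->
  exists2 C, 0 < C & forall t, P t C.
Proof.
move=> mono H.
have /choice[C HC] : forall t, exists C, 0 < C /\ P t C.
  by move=> t; have [C] := H t; exists C.
exists (1 + \sum_t C t).
  by rewrite ltr_pwDl// sumr_ge0// => t _; have [/ltW] := HC t.
move=> t; apply: mono (HC t).1 (HC t).2 _.
rewrite (bigD1 t)//= addrCA lerDl addr_ge0// sumr_ge0// => s _.
by have [/ltW] := HC s.
Qed.

(** Pigeonhole: the sets [G k] of values at most [M ^+ k * e] are nested, and [#|J| + 1] consecutive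
    strict inclusions would exceed the size of [J]. *)
Lemma gap_exists (R : realType) (J : finType) (a : J -> R) (M e : R) :
  1 <= M -> 0 <= e ->
  exists2 k, (k <= #|J|)%N & forall j, a j <= M ^+ k.+1 * e -> a j <= M ^+ k * e.
Proof.
move=> M1 e0; pose G k := [set j | a j <= M ^+ k * e]%SET.
apply: contrapT => H.
have sub k : (k <= #|J|)%N -> (#|G k| < #|G k.+1|)%N.
  move=> kJ; apply: proper_card; rewrite properE; apply/andP; split.
    apply/fintype.subsetP => j; rewrite !inE => /le_trans; apply.
    by rewrite ler_wpM2r// exprS ler_peMl// exprn_ge0// (le_trans ler01).
  apply/negP => /fintype.subsetP GG; apply: H; exists k => // j aj.
  by have := GG j; rewrite !inE; apply.
have : (#|J|.+1 <= #|G #|J|.+1|)%N.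
  suff : forall k, (k <= #|J|.+1)%N -> (k <= #|G k|)%N by apply.
  elim=> // k IH kJ; apply: leq_ltn_trans (sub _ kJ).
  by apply: IH; apply: ltnW.
by rewrite ltnNge max_card.
Qed.

(** * Finitely generated cones and normal cones of polyhedra *)

Section Polyhedra.
Context (R : realType) (X : completeNormedModType R) (dot : {dot X for idfun}).
Hypothesis hdot : forall x : X, dot x x = `|x| ^+ 2.

(** Stands in for attainment of the distance to a finitely generated cone. If the projection [p] of
    [d] onto the span has nonnegative coefficients, it attains the distance; otherwise each point of
    the cone can be replaced by one on a proper face that is no farther from [d]. *)
Lemma cone_dist_gap (J : finType) (g : J -> X) (d : X) (e : R) (S : {set J}) :
  (forall a : J -> R, (forall k, 0 <= a k) -> e < `|d - \sum_(k in S) a k *: g k|) ->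
  exists2 C, 0 < C & forall a : J -> R, (forall k, 0 <= a k) ->
    e + C^-1 <= `|d - \sum_(k in S) a k *: g k|.
Proof.
have [n] := ubnP #|S|; elim: n S => // n IH S; rewrite ltnS => Sn HS.
have [b] := span_proj hdot g d (enum_uniq S); rewrite big_enum/=.
set p := \sum_(k in S) b k *: g k => Hb.
have pyth (a : J -> R) : `|d - \sum_(k in S) a k *: g k| ^+ 2 =
    `|d - p| ^+ 2 + `|p - \sum_(k in S) a k *: g k| ^+ 2.
  rewrite -[d - \sum_(k in S) a k *: g k](subrKA p) (normD2 hdot (d - p)).
  rewrite (_ : p - \sum_(k in S) _ = \sum_(k in S) (b k - a k) *: g k).
    rewrite dot_sumr big1 ?mulr0 ?addr0// => k kS.
    by rewrite dotZr Hb ?mulr0// mem_enum.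
  by rewrite /p -sumrB; apply: eq_bigr => k _; rewrite scalerBl.
have [bp|] := pselect (forall k, k \in S -> 0 <= b k).
  have ep : e < `|d - p|.
    have := HS (fun k => if k \in S then b k else 0).
    rewrite (eq_bigr (fun k => b k *: g k)); first last.
      by move=> k ->.
    by apply=> k; case: ifP => // /bp.
  exists (`|d - p| - e)^-1; first by rewrite invr_gt0 subr_gt0.
  move=> a _; rewrite invrK subrKC.
  by rewrite -(ler_pXn2r (n := 2)) ?nnegrE// (pyth a) lerDl sqr_ge0.
move=> /existsNP[k0 /not_implyP[k0S /negP]]; rewrite -ltNge => bk0.
have zsum k (a : J -> R) : k \in S -> a k = 0 ->
    \sum_(j in S) a j *: g j = \sum_(j in S :\ k) a j *: g j.
  move=> kS ak; rewrite (bigD1 k)//= ak scale0r add0r; apply: eq_bigl => j.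
  by rewrite in_setD1 andbC.
have [||C C0 HC] := @uniform_bound R J (fun k C => k \in S ->
    forall a : J -> R, (forall k, 0 <= a k) ->
    e + C^-1 <= `|d - \sum_(j in S :\ k) a j *: g j|).
- move=> k C D C0 H CD kS a a0.
  apply: le_trans (H kS a a0); rewrite lerD2l lef_pV2// posrE//.
  exact: lt_le_trans CD.
- move=> k; have [kS|kS] := boolP (k \in S); last by exists 1.
  have [||C C0 HC] := IH (S :\ k)%SET; last by exists C.
    by rewrite (cardsD1 k S) kS in Sn.
  move=> a a0; pose a' j := if j == k then 0 else a j.
  have a'0 j : 0 <= a' j by rewrite /a'; case: ifP.
  have := HS a' a'0; rewrite (zsum k)// /a' ?eqxx//.
  rewrite (eq_bigr (fun j => a j *: g j))// => j.
  by rewrite in_setD1 => /andP[/negbTE->].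
exists C => // a a0.
(* Ratio test: on the way from [a] to [b], the coefficient with the smallest [t k] vanishes first.
   The point reached lies on the face [S :\ k] and is no farther from [p], hence by [pyth] no
   farther from [d]. *)
pose t k := a k / (a k - b k).
have bS0 : (k0 \in S) && (b k0 < 0) by rewrite k0S.
case: (@arg_minP _ R J k0 (fun k => (k \in S) && (b k < 0)) t bS0) => k /andP[kS bk] tmin.
have tp j : b j < 0 -> 0 < a j - b j.
  by move=> bj; rewrite subr_gt0 (lt_le_trans bj).
have t0 : 0 <= t k by rewrite divr_ge0// ltW// tp.
have t1 : t k <= 1 by rewrite ler_pdivrMr ?tp// mul1r lerBrDr gerDl ltW.
pose a' j := if j \in S then (1 - t k) * a j + t k * b j else 0.
have a'0 j : 0 <= a' j.
  rewrite /a'; case: ifP => // jS; have [bj|bj] := ltP (b j) 0.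
    have : t k <= t j by apply: tmin; rewrite jS.
    by rewrite ler_pdivlMr ?tp//; lra.
  by rewrite addr_ge0// mulr_ge0// subr_ge0.
have a'k : a' k = 0.
  by rewrite /a' kS /t; field; rewrite gt_eqF// tp.
apply: le_trans (HC k kS a' a'0) _; rewrite -(zsum k)//.
rewrite -(ler_pXn2r (n := 2)) ?nnegrE// (pyth a) (pyth a') lerD2l.
rewrite (_ : p - _ = (1 - t k) *: (p - \sum_(j in S) a j *: g j)).
  rewrite normrZ exprMn ler_piMl ?sqr_ge0// real_normK ?num_real//.
  by rewrite expr_le1 ?subr_ge0// lerBlDr lerDl.
rewrite scalerBr scaler_sumr [in RHS]scalerBl scale1r /p scaler_sumr -!sumrB.
apply: eq_bigr => j jS; rewrite /a' jS scalerDl !scalerA opprD addrA.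
by rewrite -!scalerBl; congr (_ *: _); ring.
Qed.

(* [h] ranges over the feasible directions at [x], with [C^-1] an admissible step. *)
Lemma normal_cone (J : finType) (S : {set J}) (g : J -> X) (b : J -> R) x y :
  (forall k, k \in S -> dot x (g k) <= b k) ->
  (forall h, (exists2 C, 0 < C & forall t, 0 <= t -> C * t <= 1 ->
      forall k, k \in S -> dot (x + t *: h) (g k) <= b k) -> dot y h <= 0) ->
  exists a : J -> R, [/\ forall k, 0 <= a k, y = \sum_k a k *: g k &
    forall k, a k != 0 -> k \in S /\ dot x (g k) = b k].
Proof.
move=> Hx Hy; pose T := [set k in S | dot x (g k) == b k]%SET.
have [|a [a0 ya]] := farkas hdot (g := g) (y := y) (enum_uniq T).
  move=> h Hh; apply: Hy.
  (* Feasibility of [h]: a tight constraint allows every step, a slack one a step proportional to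
     its slack. *)
  have [||C C0 HC] := @uniform_bound R J (fun k C => forall t, 0 <= t ->
    C * t <= 1 -> k \in S -> dot (x + t *: h) (g k) <= b k); last first.
  - by exists C => // t t0 Ct k; exact: HC.
  - move=> k; have [kT|kT] := boolP (k \in T).
      exists 1 => // t t0 _ kS; rewrite dotDl dotZl -[leRHS]addr0 lerD ?Hx//.
      by rewrite mulr_ge0_le0// dotC Hh// mem_enum.
    have [kS|kS] := boolP (k \in S); last by exists 1.
    have s0 : 0 < b k - dot x (g k).
      by rewrite subr_gt0 lt_neqAle Hx// andbT; move: kT; rewrite inE kS.
    exists ((1 + `|dot h (g k)|) / (b k - dot x (g k))).
      by rewrite divr_gt0// ltr_pwDl.
    move=> t t0; rewrite mulrAC ler_pdivrMr// mul1r => H _.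
    rewrite dotDl dotZl -lerBrDl; apply: le_trans H.
    rewrite mulrC ler_wpM2r//; have := ler_norm (dot h (g k)); lra.
  - move=> k C D C0 H CD t t0 Dt; apply: H => //; apply: le_trans Dt.
    by rewrite ler_wpM2r.
exists (fun k => if k \in T then a k else 0); split.
- by move=> k; case: ifP.
- rewrite ya big_enum/= big_mkcond; apply: eq_bigr => k _.
  by case: ifP; rewrite ?scale0r.
- by move=> k; case: ifP; rewrite ?eqxx// inE => /andP[? /eqP].
Qed.

(** Multipliers with complementary slackness: a linear objective maximal at [x] cannot increase
    along a feasible direction, as one admissible step shows. *)
Lemma normal_cone_max (J : finType) (S : {set J}) (g : J -> X) (b : J -> R) x y :
  (forall k, k \in S -> dot x (g k) <= b k) ->
  (forall q, (forall k, k \in S -> dot q (g k) <= b k) -> dot y q <= dot y x) ->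
  exists a : J -> R, [/\ forall k, 0 <= a k, y = \sum_k a k *: g k &
    forall k, a k != 0 -> k \in S /\ dot x (g k) = b k].
Proof.
move=> Hx Hy; apply: normal_cone => // h [C C0 HC].
have Ci : 0 < C^-1 by rewrite invr_gt0.
have := Hy (x + C^-1 *: h) (HC C^-1 (ltW Ci) _).
rewrite divff ?gt_eqF// => /(_ (lexx _)).
by rewrite dotDr dotZr gerDl pmulr_rle0.
Qed.

Lemma normal_cone_proj (J : finType) (S : {set J}) (g : J -> X) (b : J -> R) x z :
  (forall k, k \in S -> dot x (g k) <= b k) ->
  (forall q, (forall k, k \in S -> dot q (g k) <= b k) -> `|z - x| <= `|z - q|) ->
  exists a : J -> R, [/\ forall k, 0 <= a k, z - x = \sum_k a k *: g k &
    forall k, a k != 0 -> k \in S /\ dot x (g k) = b k].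
Proof.
move=> Hx Hz; apply: normal_cone => // h [C C0 HC]; rewrite leNgt; apply/negP => zh.
(* The first summand makes the step [N^-1] admissible; the second makes its first-order gain exceed
   the quadratic term. *)
pose N := C + (1 + `|h| ^+ 2) / dot (z - x) h.
have hh : 0 <= `|h| ^+ 2 by rewrite sqr_ge0.
have D0 : 0 < (1 + `|h| ^+ 2) / dot (z - x) h by rewrite divr_gt0// ltr_pwDl.
have N0 : 0 < N by rewrite addr_gt0.
have Ni : 0 < N^-1 by rewrite invr_gt0.
have Nt : C * N^-1 <= 1 by rewrite ler_pdivrMr// mul1r lerDl ltW.
have := Hz (x + N^-1 *: h) (HC N^-1 (ltW Ni) Nt).
rewrite opprD addrA -(ler_pXn2r (n := 2)) ?nnegrE//.
rewrite (normB2 hdot (z - x)) dotZr normrZ exprMn gtr0_norm// => H.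
have : 2 * dot (z - x) h <= N^-1 * `|h| ^+ 2.
  by rewrite -(ler_pM2l Ni); nra.
rewrite ler_pdivlMl// => H2.
have : (1 + `|h| ^+ 2) / dot (z - x) h * dot (z - x) h = 1 + `|h| ^+ 2.
  by rewrite divfK// gt_eqF.
move: H2; rewrite /N mulrDl; set E := _ / _.
have : 0 <= C * dot (z - x) h by rewrite mulr_ge0// ltW.
by nra.
Qed.

End Polyhedra.

(** * Block descent on the dual *)

Section Reach.
Context (R : realType) (X : completeNormedModType R) (dot : {dot X for idfun}).
Hypothesis hdot : forall x : X, dot x x = `|x| ^+ 2.
Context (m K : nat) (f : 'I_m -> 'I_K -> X) (c : 'I_m -> 'I_K -> R) (d : X).
Local Notation J := ('I_m * 'I_K)%type.

Definition residual (y : 'I_m -> X) : X := d - \sum_i y i.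

Definition energy (y : 'I_m -> X) (s : 'I_m -> R) : R :=
  2^-1 * `|residual y| ^+ 2 + \sum_i s i.

(** A dual certificate: by weak duality [s] bounds [dot v] wherever the constraints used hold, with
    equality wherever they are tight. *)
Definition is_rep (H : {set J}) (i : 'I_m) (v : X) (s : R) : Prop :=
  exists a : 'I_K -> R, [/\ forall r, 0 <= a r, forall r, a r != 0 -> (i, r) \in H,
    v = \sum_r a r *: f i r & s = \sum_r a r * c i r].

(* [s i] is an upper bound of the support function of the i-th set at [y i]; [U]
   collects the blocks modified so far and [H] the constraints that have been
   tight at some residual so far. *)
Inductive reach (y0 : 'I_m -> X) :
    ('I_m -> X) -> ('I_m -> R) -> {set 'I_m} -> {set J} -> Prop :=
| reach_init : reach y0 y0 (fun=> 0) finset.set0 finset.set0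
| reach_step y s U H (Q : {set 'I_m}) y' s' H' of
    reach y0 y s U H
    & (forall i, i \notin Q -> y' i = y i /\ s' i = s i)
    & (forall i, i \in Q -> [/\ dot (y i) (residual y') <= s i,
        s' i = dot (y' i) (residual y') & is_rep H' i (y' i) (s' i)])
    & (forall i, i \in Q -> i \notin U -> exists a : 'I_K -> R,
        [/\ forall r, 0 <= a r, y i = \sum_r a r *: f i r &
          forall r, a r != 0 -> c i r = 0 /\ dot (residual y') (f i r) <= 0])
    & H \subset H'
    & (forall k, k \in H' -> k \in H \/ dot (residual y') (f k.1 k.2) = c k.1 k.2) :
  reach y0 y' s' (U :|: Q) H'.

Lemma is_repS (H H' : {set J}) i v s : H \subset H' -> is_rep H i v s -> is_rep H' i v s.
Proof.
move=> /fintype.subsetP HH [a [a0 aH ? ?]]; exists a; split=> // r ar.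
exact/HH/aH.
Qed.

Lemma reach_rep y0 y s U H : reach y0 y s U H ->
  (forall i, i \in U -> is_rep H i (y i) (s i)) /\
  (forall i, i \notin U -> y i = y0 i /\ s i = 0).
Proof.
elim=> [|{U H}y1 s1 U H Q y' s' H' _ [IH1 IH2] out inn _ HH _].
  by split=> i //; rewrite inE.
split=> i; rewrite inE; have [iQ|iQ] := boolP (i \in Q); rewrite ?orbT// ?orbF.
- by move=> _; have [] := inn i iQ.
- by have [-> ->] := out i iQ => iU; apply: is_repS HH _; apply: IH1.
- by have [-> ->] := out i iQ => iU; apply: IH2.
Qed.

(** The square is expanded around [residual y']; by the choice of [s'], the cross term turns the
    change of the certificates into the slacks of the old ones at the new residual. Along [reach]
    all terms are nonnegative, so the total loss bounds each of them. *)
Lemma energy_step (Q : {set 'I_m}) y y' s s' :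
  (forall i, i \notin Q -> y' i = y i /\ s' i = s i) ->
  (forall i, i \in Q -> s' i = dot (y' i) (residual y')) ->
  energy y s - energy y' s' = 2^-1 * `|residual y - residual y'| ^+ 2
    + \sum_(i in Q) (s i - dot (y i) (residual y')).
Proof.
move=> out inn; set x' := residual y'.
have xE : residual y = x' + (residual y - x') by rewrite subrKC.
have wE : residual y - x' = \sum_(i in Q) (y' i - y i).
  rewrite /x' /residual opprB addrC subrKA -sumrB [RHS]big_mkcond; apply: eq_bigr => i _.
  by case: ifPn => // iQ; have [->] := out i iQ; rewrite subrr.
have sE : \sum_i s i - \sum_i s' i = \sum_(i in Q) (s i - s' i).
  rewrite -sumrB [RHS]big_mkcond; apply: eq_bigr => i _.
  by case: ifPn => // iQ; have [_ ->] := out i iQ; rewrite subrr.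
have dE : \sum_(i in Q) (s i - dot (y i) x') =
    \sum_(i in Q) (s i - s' i) + dot x' (residual y - x').
  rewrite wE dot_sumr -big_split; apply: eq_bigr => i iQ /=.
  by rewrite inn// -/x' (dotBr _ (y' i)) !(dotC _ x'); ring.
rewrite dE -sE /energy {1}xE (normD2 hdot); rewrite -/x'.
by set w := residual y - x'; field.
Qed.

Lemma reach_energy_le y0 y s U H : reach y0 y s U H ->
  energy y s <= energy y0 (fun=> 0).
Proof.
elim=> [|{U H}y1 s1 U H Q y' s' H' _ IH out inn _ _ _] //.
apply: le_trans IH; rewrite -subr_ge0 (energy_step out); last first.
  by move=> i /inn[].
rewrite addr_ge0 ?mulr_ge0 ?sqr_ge0 ?invr_ge0// sumr_ge0// => i iQ.
by rewrite subr_ge0; have [] := inn i iQ.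
Qed.

(* The point [x'] solves exactly all equations in which [residual y0] has a small
   defect ([<= r]); no other constraint has a defect below [M * r], so none of
   them can become tight while the residual stays within [D * r]. *)
Lemma reach_gap (B M D r e : R) (x' : X) y0 y s U H :
  0 <= B -> D = 2 * B + 2 * m%:R + 2 -> M = 2 * (D + 2) + B ->
  0 <= e <= r ->
  (forall i r', `|dot (residual y0) (f i r') - c i r'| <= M * r ->
     `|dot (residual y0) (f i r') - c i r'| <= r) ->
  (forall i r', `|dot (residual y0) (f i r') - c i r'| <= r ->
     dot x' (f i r') = c i r') ->
  (forall i r', `|f i r'| = 1) ->
  `|residual y0 - x'| <= B * r ->
  reach y0 y s U H ->
  energy y0 (fun=> 0) - energy y s <= e ^+ 2 ->
  [/\ `|residual y - residual y0| <= D * r,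
      forall k, k \in H -> `|dot (residual y0) (f k.1 k.2) - c k.1 k.2| <= r &
      forall i, i \in U -> - dot (y0 i) x' <= 2 * e ^+ 2].
Proof.
move=> B0 DE ME /andP[e0 er] gap Hx' f1 xx' Hr.
have r0 : 0 <= r by apply: le_trans er.
have m0 : 0 <= m%:R :> R by [].
have D0 : 0 <= D by rewrite DE; nra.
elim: Hr => [|{U H s y}y s U H Q y1 s1 H1 Hr IH out inn first HH H1H] loss.
  split=> [|k|i]; rewrite ?inE// subrr normr0; exact: mulr_ge0.
have Hs : energy y s - energy y1 s1 = _ :=
  energy_step out (fun i iQ => let: And3 _ E _ := inn i iQ in E).
have pos i : i \in Q -> 0 <= s i - dot (y i) (residual y1).
  by move=> iQ; rewrite subr_ge0; have [] := inn i iQ.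
have spos : 0 <= \sum_(i in Q) (s i - dot (y i) (residual y1)) by exact: sumr_ge0.
have loss1 : energy y s - energy y1 s1 <= e ^+ 2.
  by apply: le_trans loss; rewrite lerD2r; apply: reach_energy_le Hr.
have loss0 : energy y0 (fun=> 0) - energy y s <= e ^+ 2.
  apply: le_trans loss; rewrite lerD2l lerN2 -subr_ge0 Hs.
  by rewrite addr_ge0 ?mulr_ge0 ?invr_ge0 ?sqr_ge0//.
have [IHa IHb IHc] := IH loss0.
(* Bootstrap: the loss limits one step to length [2 * e], so [D] becomes [D + 2] for the moment; the
   energy argument below restores [D]. *)
have near1 : `|residual y1 - residual y0| <= (D + 2) * r.
  rewrite -(subrKA (residual y)) mulrDl; apply: le_trans (ler_normD _ _) _.
  rewrite addrC lerD// distrC; apply: le_trans (_ : 2 * e <= _); last by rewrite ler_pM2l.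
  rewrite -(ler_pXn2r (n := 2)) ?nnegrE ?mulr_ge0//.
  by move: loss1 spos (sqr_ge0 e); rewrite Hs; lra.
have IHb1 k : k \in H1 -> `|dot (residual y0) (f k.1 k.2) - c k.1 k.2| <= r.
  move=> /H1H[/IHb//|tight]; apply: gap; rewrite -tight -dotBl.
  apply: le_trans (dot_norm_le hdot _ _) _; rewrite f1 mulr1 distrC.
  by apply: le_trans near1 _; rewrite ler_wpM2r// ME; nra.
have IHc1 i : i \in U :|: Q -> - dot (y0 i) x' <= 2 * e ^+ 2.
  rewrite inE; have [/IHc//|iU /= iQ] := boolP (i \in U).
  have [a [a0 ya aP]] := first i iQ iU.
  have [_ /(_ i iU)[y0i si]] := reach_rep Hr.
  have [yx _ _] := inn i iQ; rewrite si in yx.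
  (* An untouched block still has certificate 0, so its slack at the first modification is a summand
     of the loss. *)
  have lossi : - dot (y i) (residual y1) <= e ^+ 2.
    apply: le_trans loss1; rewrite Hs (bigD1 i)//= si sub0r.
    rewrite addrCA lerDl addr_ge0 ?mulr_ge0 ?invr_ge0 ?sqr_ge0// sumr_ge0// => j /andP[jQ _].
    exact: pos.
  apply: le_trans (_ : 2 * - dot (y i) (residual y1) <= _); last by rewrite ler_pM2l.
  (* The sums are compared termwise. A normal of small defect vanishes on [x']. For a large defect,
     its value at [residual y0] is below [- M * r], and [M = 2 * (D + 2) + B] is what lets twice the
     value at [residual y1] absorb both displacements. *)
  rewrite -y0i ya !dot_suml -!sumrN mulr_sumr; apply: ler_sum => r' _.
  rewrite !dotZl -!mulrN mulrCA.
  have [->|ar] := eqVneq (a r') 0; first by rewrite !mul0r.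
  rewrite ler_wpM2l//; have [ci le0] := aP r' ar.
  rewrite [dot (f i r') x']dotC [dot (f i r') _]dotC.
  have [def|def] := leP `|dot (residual y0) (f i r') - c i r'| (M * r).
    by rewrite Hx' ?gap// ci; lra.
  rewrite ci subr0 in def.
  have n1 : `|dot (residual y1) (f i r') - dot (residual y0) (f i r')| <= (D + 2) * r.
    rewrite -dotBl; apply: le_trans (dot_norm_le hdot _ _) _.
    by rewrite f1 mulr1.
  have n2 : `|dot (residual y0) (f i r') - dot x' (f i r')| <= B * r.
    rewrite -dotBl; apply: le_trans (dot_norm_le hdot _ _) _.
    by rewrite f1 mulr1.
  move: n1 n2 def le0; rewrite !ler_norml ltr_normr => /andP[n1 n1'] /andP[n2 n2'].
  have Dr : 0 <= D * r by exact: mulr_ge0.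
  have Br : 0 <= B * r by exact: mulr_ge0.
  by rewrite ME => /orP[] H2 H3; nra.
split=> //.
set w := residual y0 - residual y1; rewrite distrC -/w.
have wE : w = \sum_(i in U :|: Q) (y1 i - y0 i).
  rewrite /w /residual opprB addrC subrKA -sumrB [RHS]big_mkcond; apply: eq_bigr => i _.
  have [_ no] := reach_rep (reach_step Hr out inn first HH H1H).
  by case: ifPn => // /no[-> _]; rewrite subrr.
have [rep no] := reach_rep (reach_step Hr out inn first HH H1H).
have sE : \sum_i s1 i = \sum_(i in U :|: Q) s1 i.
  by rewrite [RHS]big_mkcond; apply: eq_bigr => i _; case: ifPn => // /no[].
(* The constraints used by the new dual vectors have defect at most [r], so they are equalities at
   [x'] and the certificates are exact there. *)
have yx i : i \in U :|: Q -> dot (y1 i) x' = s1 i.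
  move=> /rep[a [a0 aH -> ->]]; rewrite dot_suml; apply: eq_bigr => r' _.
  rewrite dotZl; have [->|/aH/IHb1 ar] := eqVneq (a r') 0; first by rewrite !mul0r.
  by rewrite dotC Hx'.
have wx : dot w x' - \sum_i s1 i <= m%:R * (2 * e ^+ 2).
  rewrite wE dot_suml sE -sumrB.
  apply: (@le_trans _ _ (\sum_(i < m) (2 * e ^+ 2))); last first.
    by rewrite sumr_const card_ord -[leLHS]mulr_natl.
  rewrite [leRHS](bigID (fun i => i \in U :|: Q)) /= -[leLHS]addr0; apply: lerD.
    by apply: ler_sum => i iU; rewrite dotBl yx// addrAC subrr sub0r IHc1.
  by apply: sumr_ge0 => i _; rewrite mulr_ge0// sqr_ge0.
have wz : dot w (residual y0 - x') <= `|w| * (B * r).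
  by apply: le_trans (dot_le hdot _ _) _; rewrite ler_wpM2l.
have E1 : energy y1 s1 <= energy y0 (fun=> 0).
  exact: reach_energy_le (reach_step Hr out inn first HH H1H).
(* The energy inequality expanded at [residual y0], with [x'] inserted to cancel the certificates.
   It is quadratic in the length of [w], and [D] is chosen to exceed its solutions. *)
have main : 2^-1 * `|w| ^+ 2 <= m%:R * (2 * r ^+ 2) + `|w| * (B * r).
  have : `|residual y1| ^+ 2 = `|residual y0| ^+ 2 - 2 * dot (residual y0) w + `|w| ^+ 2.
    by rewrite -(normB2 hdot) /w opprB addrC subrK.
  have E2 : dot (residual y0) w = dot w x' + dot w (residual y0 - x').
    by rewrite dotBr addrC subrK dotC.
  have : m%:R * (2 * e ^+ 2) <= m%:R * (2 * r ^+ 2).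
    by rewrite ler_wpM2l// ler_pM2l// lerXn2r ?nnegrE.
  move: E1; rewrite /energy big1_eq E2; lra.
rewrite leNgt; apply/negP => wD.
have w0 : 0 <= `|w| by [].
have w1 : 0 < `|w| by apply: le_lt_trans wD; exact: mulr_ge0.
have : D * r * `|w| < `|w| * `|w| by rewrite ltr_pM2r.
have : m%:R * r * (2 * r) <= m%:R * r * `|w|.
  rewrite ler_wpM2l ?mulr_ge0//; apply: le_trans (ltW wD).
  by rewrite ler_wpM2r// DE; nra.
have : 0 <= `|w| * r by rewrite mulr_ge0.
move: main; rewrite DE !expr2; nra.
Qed.

End Reach.

(** * The contraction estimate for block descent *)

Section Estimate.
Context (R : realType) (X : completeNormedModType R) (dot : {dot X for idfun}).
Hypothesis hdot : forall x : X, dot x x = `|x| ^+ 2.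
Context (m K : nat) (f : 'I_m -> 'I_K -> X) (c : 'I_m -> 'I_K -> R) (d : X).
Hypothesis f1 : forall i r, `|f i r| = 1.
Local Notation J := ('I_m * 'I_K)%type.
Local Notation g := (fun k : J => f k.1 k.2).

Lemma eq_error_bound_uniform (b : J -> R) :
  exists2 C : R, 0 < C & forall (G : {set J}) x t, 0 <= t -> C * t <= 1 ->
    (forall k, k \in G -> `|dot x (g k) - b k| <= t) ->
    exists2 x', (forall k, k \in G -> dot x' (g k) = b k) & `|x - x'| <= C * t.
Proof.
apply: uniform_bound => [G C D C0 H CD x t t0 Dt Hx|G].
  have CDt : C * t <= D * t by rewrite ler_wpM2r.
  have [x' ? xx'] := H x t t0 (le_trans CDt Dt) Hx.
  by exists x' => //; apply: le_trans CDt.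
have [C C0 HC] := eq_error_bound hdot g b (enum_uniq G).
exists C => // x t t0 Ct Hx; have [|x' Hx' ?] := HC x t t0 Ct.
  by move=> k; rewrite mem_enum; apply: Hx.
by exists x' => // k kG; apply: Hx'; rewrite mem_enum.
Qed.

Lemma reach_near : exists2 C : R, 0 < C & forall y0 e, 0 <= e -> C * e <= 1 ->
  forall y s U H, reach dot f c d y0 y s U H ->
    energy d y0 (fun=> 0) - energy d y s <= e ^+ 2 ->
    `|residual d y - residual d y0| <= C * e /\
    forall k, k \in H -> `|dot (residual d y0) (g k) - c k.1 k.2| <= C * e.
Proof.
have [B B0 HB] := eq_error_bound_uniform (fun k => c k.1 k.2).
have m0 : 0 <= m%:R :> R by [].
pose D := 2 * B + 2 * m%:R + 2; pose M := 2 * (D + 2) + B.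
have D1 : 1 <= D by rewrite /D; nra.
have D0 : 0 <= D by exact: le_trans D1.
have M1 : 1 <= M by rewrite /M; nra.
have M0 : 0 <= M by exact: le_trans M1.
(* The power of [M] is the largest scale the pigeonhole can return; [D] serves the conclusion, and
   [B] the smallness condition of the error bound. *)
pose C := (D + B) * M ^+ #|{: J}|.
have MN : 1 <= M ^+ #|{: J}| by rewrite exprn_ege1.
exists C; first by rewrite mulr_gt0 ?(lt_le_trans _ MN)// ltr_wpDl.
move=> y0 e e0 Ce y s U H Hr loss.
have [k kJ gap] := gap_exists
  (fun k : J => `|dot (residual d y0) (g k) - c k.1 k.2|) M1 e0.
set r := M ^+ k * e in gap.
have er : e <= r by rewrite ler_peMl// exprn_ege1.
have r0 : 0 <= r by exact: le_trans er.
have rC : (D + B) * r <= C * e.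
  have DB0 : 0 <= D + B by apply: addr_ge0 => //; exact: ltW.
  rewrite /C -mulrA; apply: ler_wpM2l => //.
  by rewrite /r ler_wpM2r// ler_weXn2l.
have Br : 0 <= B * r by rewrite mulr_ge0// ltW.
have Dr : r <= D * r by rewrite ler_peMl.
pose G := [set k : J | `|dot (residual d y0) (g k) - c k.1 k.2| <= r]%SET.
have [||x' Hx' xx'] := HB G (residual d y0) r r0.
- by apply: le_trans Ce; apply: le_trans rC; rewrite mulrDl; lra.
- by move=> j; rewrite inE.
have [|||a b _] := @reach_gap R X dot hdot m K f c d B M D r e x' y0 y s U H
    (ltW B0) erefl erefl _ _ _ f1 xx' Hr loss.
- by rewrite e0.
- by move=> i j Mr; apply: (gap (i, j)); rewrite exprS -mulrA.
- by move=> i j ij; apply: (Hx' (i, j)); rewrite inE.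
split; first by apply: le_trans a _; apply: le_trans rC; rewrite (mulrDl D); lra.
by move=> j /b jH; apply: le_trans jH _; apply: le_trans rC; rewrite (mulrDl D); lra.
Qed.

Context (ok : {set J}) (eh : R).
Hypothesis eh0 : 0 < eh.
Hypothesis c0 : forall i r, 0 <= c i r.
Hypothesis hat : forall a : J -> R, (forall k, 0 <= a k) ->
  (forall k, a k != 0 -> k \in ok /\ c k.1 k.2 = 0) ->
  `|d - \sum_k a k *: g k| <= eh -> in_span [set k | 0 < a k] g d.

(** If [d] is not in the span of a set of normals, [hat] keeps their cone at distance more than [eh]
    from [d], and [cone_dist_gap] adds a margin, uniform over the finitely many sets. The margin
    leaves room for a residual perturbed by [O(e)]. *)
Lemma hat_margin : exists2 C : R, 0 < C & forall a : J -> R, (forall k, 0 <= a k) ->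
  (forall k, a k != 0 -> k \in ok /\ c k.1 k.2 = 0) ->
  `|d - \sum_k a k *: g k| < eh + C^-1 -> in_span [set k | 0 < a k] g d.
Proof.
have [||C C0 HC] := @uniform_bound R {set J} (fun S C =>
    (forall k, k \in S -> k \in ok /\ c k.1 k.2 = 0) ->
    ~ in_span [set` S] g d -> forall a : J -> R, (forall k, 0 <= a k) ->
    eh + C^-1 <= `|d - \sum_(k in S) a k *: g k|).
- move=> S C D C0 H CD Sok Sd a a0; apply: le_trans (H Sok Sd a a0).
  by rewrite lerD2l lef_pV2// posrE (lt_le_trans C0).
- move=> S; have [Sok|nSok] := pselect (forall k, k \in S -> k \in ok /\ c k.1 k.2 = 0);
    last by exists 1.
  have [Sd|nSd] := pselect (in_span [set` S] g d); first by exists 1.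
  have [|C C0 HC] := @cone_dist_gap R X dot hdot J g d eh S; last by exists C.
  move=> a a0; rewrite ltNge; apply/negP => H; apply: nSd.
  have [|||b [b0 db]] := hat (a := fun k => if k \in S then a k else 0).
  + by move=> k; case: ifP.
  + by move=> k; case: ifP => [/Sok//|]; rewrite eqxx.
  + apply: le_trans H; rewrite [in leRHS]big_mkcond le_eqVlt; apply/orP; left; apply/eqP.
    by congr (`|_ - _|); apply: eq_bigr => k _; case: ifP; rewrite ?scale0r.
  exists b; split=> // k /= kS; apply: b0 => /=.
  by case: ifP => // kS'; rewrite ?ltxx.
exists C => // a a0 ak lt.
pose S := [set k | 0 < a k]%SET.
have SE : [set` S] = [set k | 0 < a k].
  by apply/seteqP; split=> k /=; rewrite inE.
rewrite -SE; apply: contrapT => nS.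
have := HC S _ nS a a0; rewrite leNgt => H.
have : ~~ (`|d - \sum_(k in S) a k *: g k| < eh + C^-1).
  by apply: H => k; rewrite inE => /gt_eqF/negbT/ak.
move=> /negP; apply; rewrite [X in d - X](_ : _ = \sum_k a k *: g k)//.
rewrite big_mkcond; apply: eq_bigr => k _; case: ifPn => //.
by rewrite inE -leNgt => ak0; rewrite (@le_anti _ _ (a k) 0) ?scale0r// ak0 a0.
Qed.

Lemma reach_full_bound : exists2 C : R, 0 < C & forall y0 e, 0 <= e -> C * e <= 1 ->
  forall y s H, reach dot f c d y0 y s [set: 'I_m]%SET H -> H \subset ok ->
    `|residual d y0| <= eh ->
    energy d y0 (fun=> 0) - energy d y s <= e ^+ 2 -> `|residual d y| <= C * e.
Proof.
have [C1 C10 near] := reach_near.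
have [C2 C20 err] := eq_error_bound_uniform (fun=> 0).
have [C3 C30 margin] := hat_margin.
have [||C4 C40 cmin] := @uniform_bound R J (fun k C => 0 < c k.1 k.2 -> 1 <= C * c k.1 k.2).
- by move=> k C D _ H CD ck; apply: le_trans (H ck) _; rewrite ler_wpM2r// ltW.
- move=> k; have [ck|ck] := ltP 0 (c k.1 k.2); last by exists 1.
  by exists (c k.1 k.2)^-1; rewrite ?invr_gt0// mulVf// gt_eqF.
pose N : R := #|{: J}|%:R; have N0 : 0 <= N by [].
(* [A * e] bounds the total weight of the constraints with positive constant *)
pose A := N * (C4 * (eh * C1)); pose T := 2 * C1 + A.
have A0 : 0 <= A by rewrite !mulr_ge0// ltW.
have T0 : 0 < T by rewrite ltr_wpDr// mulr_gt0.
have C2T : 0 < C2 * T by rewrite mulr_gt0.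
(* The summands meet the smallness conditions of [near], [err] and [margin] in turn; [C2 * T + A] is
   the final bound. *)
exists (C1 + C2 * T + 2 * C3 * A + A).
  by rewrite !ltr_wpDr// !mulr_ge0// ltW.
move=> y0 e e0 Ce y s H Hr Hok x0eh loss.
have C1e : 0 <= C1 * e by rewrite mulr_ge0// ltW.
have C2Te : 0 <= C2 * T * e by rewrite mulr_ge0// ltW.
have Ae : 0 <= A * e by rewrite mulr_ge0.
have CAe : 0 <= C3 * A * e by rewrite !mulr_ge0// ltW.
have [|xx0 Hdef] := near y0 e e0 _ y s _ H Hr loss.
  by move: Ce; rewrite !mulrDl; lra.
have [rep _] := reach_rep Hr.
have /choice[a Ha] : forall i, exists a : 'I_K -> R, [/\ forall r, 0 <= a r,
    forall r, a r != 0 -> (i, r) \in H, y i = \sum_r a r *: f i r &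
    s i = \sum_r a r * c i r].
  by move=> i; apply: rep; rewrite inE.
have a0 i r : 0 <= a i r by have [] := Ha i.
have aH i r : a i r != 0 -> (i, r) \in H by have [_ + _ _] := Ha i; apply.
have s0 i : 0 <= s i.
  by have [_ _ _ ->] := Ha i; apply: sumr_ge0 => r _; exact: mulr_ge0.
have E := reach_energy_le hdot Hr; rewrite /energy big1_eq addr0 in E.
have ss0 : 0 <= \sum_i s i by exact: sumr_ge0.
have xle : `|residual d y| <= `|residual d y0|.
  by rewrite -(ler_pXn2r (n := 2)) ?nnegrE//; lra.
(* The certificates are paid for by half the drop of the squared norm, a difference of squares: one
   factor is at most [C1 * e], the other at most [2 * eh]. *)
have sle : \sum_i s i <= eh * (C1 * e).
  have : `|residual d y0| - `|residual d y| <= C1 * e.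
    by apply: le_trans xx0; rewrite (distrC (residual d y)); apply: lerB_dist.
  have : 0 <= `|residual d y| by [].
  move: E xle x0eh; set p := `|residual d y0|; set q := `|residual d y|; nra.
have ale i r : c i r != 0 -> a i r <= C4 * (eh * (C1 * e)).
  move=> cn; have cp : 0 < c i r by rewrite lt_neqAle eq_sym cn c0.
  have ac : a i r * c i r <= eh * (C1 * e).
    apply: le_trans sle; rewrite (bigD1 i)//= -[leLHS]addr0 lerD ?sumr_ge0//.
    have [_ _ _ ->] := Ha i; rewrite (bigD1 r)//= lerDl sumr_ge0// => j _.
    exact: mulr_ge0.
  have /= c1 := cmin (i, r) cp.
  apply: le_trans (_ : a i r * (C4 * c i r) <= _); first by rewrite ler_peMr.
  by rewrite mulrCA ler_wpM2l// ltW.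
(* The weights are split by whether the constant is zero. Dropping the part [l'], of total weight
   [O(e)], gives a point [x] to which [margin] applies. *)
pose l (k : J) := if c k.1 k.2 == 0 then a k.1 k.2 else 0.
pose l' (k : J) := if c k.1 k.2 == 0 then 0 else a k.1 k.2.
have yE : \sum_i y i = \sum_k l k *: g k + \sum_k l' k *: g k.
  rewrite -big_split /=.
  rewrite (eq_bigr (fun i => \sum_r a i r *: f i r)); last by move=> i _; have [] := Ha i.
  rewrite pair_bigA; apply: eq_bigr => k _ /=; rewrite /l /l'.
  by case: ifP => _; rewrite scale0r ?addr0 ?add0r.
set x := d - \sum_k l k *: g k.
have xE : x - residual d y = \sum_k l' k *: g k.
  by rewrite /x /residual opprB addrC subrKA yE addrC addKr.
have xA : `|x - residual d y| <= A * e.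
  rewrite xE; apply: le_trans (ler_norm_sum _ _ _) _.
  rewrite (_ : A * e = \sum_(k : J) (C4 * (eh * (C1 * e)))); last first.
    by rewrite sumr_const -mulr_natl /A /N -!mulrA.
  apply: ler_sum => k _; rewrite normrZ f1 mulr1 /l'; case: ifPn => [_|cn].
    by rewrite normr0 !mulr_ge0// ltW.
  by rewrite ger0_norm// ale.
have lP k : l k != 0 -> k \in ok /\ c k.1 k.2 = 0.
  rewrite /l; have [ck|_] := eqVneq (c k.1 k.2) 0; last by rewrite eqxx.
  move=> ak; split=> //; apply: (fintype.subsetP Hok).
  by rewrite [k]surjective_pairing; exact: aH.
have l0 k : 0 <= l k by rewrite /l; case: ifP.
have [|b [b0 db]] := margin l l0 lP.
  apply: le_lt_trans (_ : eh + A * e < _).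
    rewrite -/x -(subrK (residual d y) x) addrC; apply: le_trans (ler_normD _ _) _.
    by rewrite lerD// (le_trans xle).
  rewrite ltrD2l -(ltr_pM2l C30) divff ?gt_eqF// mulrA.
  by move: Ce; rewrite !mulrDl; nra.
(* The normals carrying [l] were tight with zero constant, so [x] is almost orthogonal to them; [z]
   is a nearby point that is exactly orthogonal. *)
have [|||z Hz xz] := err [set k | 0 < l k]%SET x (T * e).
- by rewrite mulr_ge0// ltW.
- by rewrite mulrA; move: Ce; rewrite !mulrDl; lra.
- move=> k; rewrite inE => lk; have [kok ck] := lP k (negbT (gt_eqF lk)).
  have kH : k \in H.
    rewrite [k]surjective_pairing; apply: aH; move: lk; rewrite /l ck eqxx.
    by move=> /gt_eqF ->.
  have := Hdef k kH; rewrite ck !subr0 => Hk.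
  rewrite -(subrK (residual d y0) x) dotDl; apply: le_trans (ler_normD _ _) _.
  have : `|dot (x - residual d y0) (g k)| <= A * e + C1 * e.
    apply: le_trans (dot_norm_le hdot _ _) _; rewrite f1 mulr1.
    rewrite -(subrKA (residual d y)); apply: le_trans (ler_normD _ _) _.
    exact: lerD.
  by move: Hk; rewrite /T !mulrDl; lra.
(* Both [d] and the subtracted sum lie in the span of the normals carrying [l], hence so does
   [x]. *)
have xz0 : dot x z = 0.
  rewrite /x db -sumrB dot_suml big1// => k _; rewrite -scalerBl dotZl dotC.
  have [lk|lk] := ltP 0 (l k); first by rewrite Hz ?inE// mulr0.
  rewrite b0 /=; last by rewrite ltNge lk.
  by rewrite (@le_anti _ _ (l k) 0) ?subrr ?mul0r// lk l0.
have xT : `|x| <= C2 * T * e.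
  have xx : `|x| ^+ 2 <= `|x| * (C2 * (T * e)).
    rewrite -hdot -[leLHS]subr0 -xz0 -dotBr; apply: le_trans (dot_le hdot _ _) _.
    by rewrite ler_wpM2l.
  have [->|xn] := eqVneq x 0; first by rewrite normr0.
  by move: xx; rewrite expr2 ler_pM2l ?normr_gt0// mulrA.
rewrite -(subrK x (residual d y)); apply: le_trans (ler_normD _ _) _.
by move: xA; rewrite distrC !mulrDl; lra.
Qed.

(** Nonnegative certificates give a drop of the squared norm of at least [2 * e ^+ 2]. For small [e]
    this is combined with the bound [C * e] on the final norm; for large [e] the drop is a fixed
    fraction of [eh ^+ 2], hence of the initial squared norm. *)
Lemma reach_contraction : exists rho : R, 0 <= rho < 1 /\
  forall y0 y s H, reach dot f c d y0 y s [set: 'I_m]%SET H -> H \subset ok ->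
    `|residual d y0| <= eh -> `|residual d y| <= rho * `|residual d y0|.
Proof.
have [C C0 HC] := reach_full_bound.
(* [q1] serves when the energy loss exceeds [C^-2], [q2] otherwise. *)
pose q1 : R := 1 - 2 * C ^- 2 / eh ^+ 2; pose q2 : R := C ^+ 2 / (2 + C ^+ 2).
have C2 : 0 < C ^+ 2 by rewrite exprn_gt0.
have q20 : 0 <= q2 by rewrite divr_ge0 ?addr_ge0// ltW.
have q21 : q2 < 1 by rewrite ltr_pdivrMr ?addr_gt0// mul1r ltrDr.
have q11 : q1 < 1 by rewrite /q1 gtrBl divr_gt0 ?exprn_gt0// mulr_gt0 ?invr_gt0.
have eh2 : 0 < eh ^+ 2 by rewrite exprn_gt0.
(* [q1] may be negative; [q2] keeps the maximum nonnegative. *)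
pose q := Num.max q1 q2.
have q0 : 0 <= q by rewrite le_max q20 orbT.
have qlt : q < 1 by rewrite gt_max q11.
exists (Num.sqrt q); rewrite sqrtr_ge0 -sqrtr1 ltr_sqrt//; split=> //.
move=> y0 y s H Hr Hok x0.
rewrite -(ler_pXn2r (n := 2)) ?nnegrE ?mulr_ge0 ?sqrtr_ge0// exprMn sqr_sqrtr//.
have E := reach_energy_le hdot Hr.
pose e := Num.sqrt (energy d y0 (fun=> 0) - energy d y s).
have e2 : e ^+ 2 = energy d y0 (fun=> 0) - energy d y s by rewrite sqr_sqrtr ?subr_ge0.
have e0 : 0 <= e by rewrite sqrtr_ge0.
have [rep _] := reach_rep Hr.
have ss0 : 0 <= \sum_i s i.
  apply: sumr_ge0 => i _; have [|a [a0 _ _ ->]] := rep i; first by rewrite inE.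
  by apply: sumr_ge0 => r _; rewrite mulr_ge0.
have loss : `|residual d y| ^+ 2 <= `|residual d y0| ^+ 2 - 2 * e ^+ 2.
  by rewrite e2 /energy big1_eq; lra.
have x02 : `|residual d y0| ^+ 2 <= eh ^+ 2 by rewrite lerXn2r ?nnegrE// ltW.
have [Ce|Ce] := leP (C * e) 1.
  have := HC y0 e e0 Ce y s H Hr Hok x0; rewrite e2 => /(_ (lexx _)) xe.
  apply: le_trans (_ : q2 * `|residual d y0| ^+ 2 <= _); last first.
    by rewrite ler_wpM2r ?sqr_ge0// le_max lexx orbT.
  have : `|residual d y| ^+ 2 <= C ^+ 2 * e ^+ 2.
    by rewrite -exprMn lerXn2r ?nnegrE// mulr_ge0// ltW.
  move=> ye; rewrite /q2 mulrAC ler_pdivlMr ?addr_gt0//.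
  by move: loss ye; set p := _ ^+ 2; nra.
apply: le_trans (_ : q1 * `|residual d y0| ^+ 2 <= _); last first.
  by rewrite ler_wpM2r ?sqr_ge0// le_max lexx.
apply: le_trans loss _; rewrite /q1 mulrBl mul1r lerD2l lerN2.
have : C ^- 2 <= e ^+ 2.
  rewrite -(ler_pM2l C2) divff ?gt_eqF// -exprMn.
  by rewrite exprn_ege1// ltW.
move=> Ce2; rewrite mulrAC ler_pdivrMr// -[leRHS]mulrA.
rewrite -mulrA ler_pM2l// ler_pM//; first by rewrite invr_ge0 ltW.
Qed.

End Estimate.

(** * Runs of the algorithm *)

Lemma last_visit0 (m : nat) (s : int -> 'I_m) (i : 'I_m) :
  (forall i : 'I_m, s (i.+1%:Z - m%:Z) = i) ->
  last_visit s 0 i = i.+1%:Z - m%:Z.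
Proof.
move=> Hs; rewrite /last_visit; congr (Posz _ - _).
apply/eqP; rewrite eqn_leq; apply/andP; split.
  apply/bigmax_leqP => k /eqP; rewrite addn0 in k *.
  by rewrite Hs => ->.
have im : (i < m + 0)%N by rewrite addn0.
by apply: (bigop.bigmax_sup (Ordinal im)) => /=; rewrite ?Hs.
Qed.

Lemma last_visitS (m : nat) (s : int -> 'I_m) (j : nat) (i : 'I_m) :
  last_visit s j.+1 i = if s j.+1 == i then j.+1%:Z else last_visit s j i.
Proof.
have E : (m + j).+1%:Z - m%:Z = j.+1%:Z by rewrite -addnS PoszD addrC addKr.
rewrite /last_visit addnS big_mkcond big_ord_recr /= E -big_mkcond /=.
case: ifP => _; last by rewrite maxn0.
rewrite (maxn_idPr _) ?E//; apply/bigmax_leqP => k _.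
exact: leqW.
Qed.

(** * Support functions and optimality conditions of the SHQP subproblem *)

Section Support.
Context (R : realType) (X : completeNormedModType R) (dot : {dot X for idfun}).
Hypothesis hdot : forall x : X, dot x x = `|x| ^+ 2.

Lemma support_fun_leP (D : set X) y (v : R) :
  (support_fun dot y D <= v%:E)%E <-> forall q, D q -> dot y q <= v.
Proof.
split=> [H q Dq|H].
  by rewrite -lee_fin; apply: le_trans H; apply: ereal_sup_ubound; exists q.
by apply: ge_ereal_sup => _ [q Dq <-]; rewrite lee_fin H.
Qed.

Lemma support_fun_ge0 (D : set X) y : D 0 -> (0 <= support_fun dot y D)%E.
Proof. by move=> D0; apply: ereal_sup_ubound; exists 0; rewrite ?dot0r. Qed.

(** The limit [t -> 0], used after dividing a variational inequality by [t]; the contradiction comes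
    from one [t] with [t * N < a - b]. *)
Lemma le_affine0 (a b N : R) : (forall t, 0 < t <= 1 -> a <= b + t * N) -> a <= b.
Proof.
move=> H; rewrite leNgt; apply/negP => ba.
pose t := (a - b) / (a - b + `|N| + 1).
have ab : 0 < a - b by rewrite subr_gt0.
have N0 : 0 <= `|N| by [].
have D0 : 0 < a - b + `|N| + 1 by lra.
have t0 : 0 < t by rewrite divr_gt0.
have tE : t * (a - b + `|N| + 1) = a - b by rewrite /t divfK// gt_eqF.
have t1 : t <= 1 by rewrite ler_pdivrMr//; lra.
have := H t; rewrite t0 t1 => /(_ isT).
have := ler_norm N; nra.
Qed.

Context (m : nat) (d : X).

Section Variation.
Context (Q : {set 'I_m}) (P : 'I_m -> set X) (y y' : 'I_m -> X).
Hypothesis out : forall i, i \notin Q -> y' i = y i.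
Hypothesis opt : forall yt, (shqp_obj dot d Q P y y' <= shqp_obj dot d Q P y yt)%E.
Hypothesis P0 : forall i, i \in Q -> P i 0.
Hypothesis fin : forall i, i \in Q -> exists v : R, (support_fun dot (y i) (P i) <= v%:E)%E.

Let resE yt : (forall i, i \notin Q -> yt i = y i) ->
  d - \sum_(i | i \notin Q) y i - \sum_(i in Q) yt i = residual d yt.
Proof.
move=> ytE; rewrite /residual [in RHS](bigID (mem Q)) /= opprD addrA [RHS]addrAC.
congr (_ - _ - _).
by apply: eq_bigr => i iQ; rewrite ytE.
Qed.

(** Comparison with the old vectors bounds the optimal value, and since 0 lies in each [P i] no
    support term is negative. *)
Lemma shqp_fin i : i \in Q -> exists p : R, support_fun dot (y' i) (P i) = p%:E.
Proof.
move=> iQ; have /choice[v Hv] : forall i, exists v : R, i \in Q ->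
    (support_fun dot (y i) (P i) <= v%:E)%E.
  move=> j; have [jQ|] := boolP (j \in Q); last by exists 0.
  by have [v Hv] := fin jQ; exists v.
have sge j : j \in Q -> (0 <= support_fun dot (y' j) (P j))%E.
  by move=> /P0; exact: support_fun_ge0.
have : (support_fun dot (y' i) (P i) <=
    (2^-1 * `|residual d y| ^+ 2 + \sum_(j in Q) v j)%:E)%E.
  apply: (@le_trans _ _ (shqp_obj dot d Q P y y)).
    apply: le_trans (opt y); rewrite /shqp_obj [X in (_ <= _ + X)%E](bigD1 i)//= addeCA.
    rewrite leeDl//; apply: adde_ge0; first by rewrite lee_fin mulr_ge0 ?invr_ge0 ?sqr_ge0.
    by apply: sume_ge0 => j /andP[jQ _]; exact: sge.
  rewrite /shqp_obj resE// EFinD leeD2l// -sumEFin.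
  by apply: lee_sum => j jQ; apply: Hv.
have := sge i iQ; case: support_fun => // p _ _; by exists p.
Qed.

(** Only block [i] is changed; the remaining support terms are finite by [shqp_fin] and cancel. *)
Lemma shqp_variation i u (p v : R) : i \in Q ->
  support_fun dot (y' i) (P i) = p%:E -> (forall q, P i q -> dot u q <= v) ->
  2^-1 * `|residual d y'| ^+ 2 + p <= 2^-1 * `|residual d y' + y' i - u| ^+ 2 + v.
Proof.
move=> iQ py uv; have /choice[pp Hp] : forall i, exists p : R, i \in Q ->
    support_fun dot (y' i) (P i) = p%:E.
  move=> j; have [jQ|] := boolP (j \in Q); last by exists 0.
  by have [p' Hp'] := shqp_fin jQ; exists p'.
pose yt j := if j == i then u else y' j.
have ytQ j : j \notin Q -> yt j = y j.
  by rewrite /yt; case: eqP => [->|_ /out//]; rewrite iQ.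
have resyt : residual d yt = residual d y' + y' i - u.
  rewrite /residual (bigD1 i)//= [in RHS](bigD1 i)//= /yt eqxx.
  rewrite (eq_bigr y'); last by move=> j /negbTE->.
  by rewrite !opprD (addrC (- y' i)) !addrA subrK addrAC.
have := opt yt; rewrite /shqp_obj resE// resE// resyt.
rewrite (bigD1 i)//= py [X in (_ <= _ + X)%E](bigD1 i)//=.
rewrite {1}/yt eqxx.
rewrite (eq_bigr (fun j => (pp j)%:E)); last by move=> j /andP[jQ _]; rewrite Hp.
rewrite [X in (_ <= _ + (_ + X))%E](eq_bigr (fun j => (pp j)%:E)); last first.
  by move=> j /andP[jQ /negbTE ji]; rewrite /yt ji Hp.
rewrite sumEFin; set s := \sum_(_ | _) _ => H.
have : (support_fun dot u (P i) <= v%:E)%E by apply/support_fun_leP.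
move=> Hu; have := le_trans H (leeD2l _ (leeD2r _ Hu)).
by rewrite -!EFinD lee_fin !addrA => {}H; rewrite -(lerD2r s).
Qed.

(** Two variations of block [i]: adding [t *: g k] raises the support by at most [t * b k] and
    yields feasibility; scaling by [1 - t] yields that the support of [y' i] is attained at the
    residual. *)
Lemma shqp_optimality (J : finType) (S : {set J}) (g : J -> X) (b : J -> R) i :
  i \in Q -> P i = [set q | forall k, k \in S -> dot q (g k) <= b k] ->
  P i (residual d y') /\
  forall q, P i q -> dot (y' i) q <= dot (y' i) (residual d y').
Proof.
move=> iQ PE; have [p py] := shqp_fin iQ; set x := residual d y'.
have Hp : forall q, P i q -> dot (y' i) q <= p.
  by apply/support_fun_leP; rewrite py.
split.
  rewrite PE => k kS; apply: (@le_affine0 _ _ (2^-1 * `|g k| ^+ 2)) => t /andP[t0 t1].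
  have uv q : P i q -> dot (y' i + t *: g k) q <= p + t * b k.
    move=> Pq; rewrite dotDl dotZl lerD ?Hp// ler_wpM2l ?(ltW t0)// dotC.
    by move: Pq; rewrite PE; apply.
  have xE : x + y' i - (y' i + t *: g k) = x - t *: g k by rewrite opprD addrA addrK.
  have := shqp_variation iQ py uv; rewrite -/x xE (normB2 hdot x).
  rewrite dotZr normrZ exprMn gtr0_norm// => H.
  by rewrite -(ler_pM2l t0); nra.
move=> q /Hp Hq; apply: le_trans Hq _; rewrite [leRHS]dotC.
apply: (@le_affine0 _ _ (2^-1 * `|y' i| ^+ 2)) => t /andP[t0 t1].
have uv q' : P i q' -> dot ((1 - t) *: y' i) q' <= (1 - t) * p.
  by move=> /Hp Pq; rewrite dotZl ler_wpM2l// subr_ge0.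
have xE : x + y' i - (1 - t) *: y' i = x + t *: y' i.
  by rewrite scalerBl scale1r opprB addrA addrAC addrK.
have := shqp_variation iQ py uv; rewrite -/x xE (normD2 hdot x).
rewrite dotZr normrZ exprMn gtr0_norm// => H.
by rewrite -(ler_pM2l t0); nra.
Qed.

End Variation.
End Support.

(** * Dykstra and SHQP steps as block descent steps *)

Section Steps.
Context (R : realType) (X : completeNormedModType R) (dot : {dot X for idfun}).
Hypothesis hdot : forall x : X, dot x x = `|x| ^+ 2.
Context (m K : nat) (f : 'I_m -> 'I_K -> X) (c : 'I_m -> 'I_K -> \bar R) (d : X).
Hypothesis hc : forall i r, c i r != -oo%E.
Hypothesis c0 : forall i r, (0 <= c i r)%E.
Local Notation J := ('I_m * 'I_K)%type.
Local Notation cr := (fun i r => fine (c i r)).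
Local Notation C := (Cset dot f c).

(** Since [fine] sends [+oo] to 0, a trivial halfspace would otherwise look like one with 0 on its
    boundary. *)
Definition finite_pairs : {set J} := [set k | c k.1 k.2 \is a fin_num]%SET.
Local Notation ok := finite_pairs.

Lemma halfspaceP i r x :
  halfspace dot f c i r x <-> ((i, r) \in ok -> dot x (f i r) <= fine (c i r)).
Proof.
rewrite /halfspace /finite_pairs inE /=; have := hc i r.
case: (c i r) => [v||] //= _; last by split=> // _; exact: leey.
by rewrite lee_fin; split=> [//|]; apply.
Qed.

Lemma CsetP i x :
  C i x <-> forall r, (i, r) \in ok -> dot x (f i r) <= fine (c i r).
Proof. by split=> [H r|H r _]; [apply/halfspaceP; apply: H|apply/halfspaceP/H]. Qed.

Lemma hyperplane0 i r : hyperplane dot f c i r 0 <-> (i, r) \in ok /\ fine (c i r) = 0.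
Proof.
rewrite /hyperplane /finite_pairs inE /= dot0l; split=> [<-//|[fc c0']].
by rewrite -c0' fineK.
Qed.

Lemma fine_c0 i r : 0 <= fine (c i r).
Proof. exact: fine_ge0. Qed.

Lemma C0 i : C i 0.
Proof. by apply/CsetP => r _; rewrite dot0l fine_c0. Qed.

(** The form of the vectors [e j j]: a cut [dot (e j j) x <= 0] is then a consequence of constraints
    already recorded in [H], all with zero constant. *)
Definition is_rep0 (H : {set J}) (i : 'I_m) (v : X) : Prop :=
  exists a : 'I_K -> R, [/\ forall r, 0 <= a r,
    forall r, a r != 0 -> (i, r) \in H /\ fine (c i r) = 0 &
    v = \sum_r a r *: f i r].

Lemma is_rep0_sub (H H' : {set J}) i v : H \subset H' -> is_rep0 H i v -> is_rep0 H' i v.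
Proof.
move=> /fintype.subsetP HH [a [a0 aH ?]]; exists a; split=> // r /aH[? ?].
by split=> //; apply: HH.
Qed.

Section Step.
Context (y0 y : 'I_m -> X) (s : 'I_m -> R) (U : {set 'I_m}) (H : {set J}).
Hypothesis Hr : reach dot f cr d y0 y s U H.
Hypothesis Hok : H \subset ok.
Hypothesis Hy0 : forall i q, C i q -> dot (y0 i) q <= 0.

Definition tight (x : X) : {set J} :=
  H :|: [set k in ok | dot x (f k.1 k.2) == fine (c k.1 k.2)].

Lemma tight_ok x : tight x \subset ok.
Proof.
apply/fintype.subsetP => k; rewrite finset.in_setU.
by move=> /orP[/(fintype.subsetP Hok)//|]; rewrite inE => /andP[].
Qed.

Lemma tight_cases x k : k \in tight x ->
  k \in H \/ dot x (f k.1 k.2) = fine (c k.1 k.2).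
Proof.
by rewrite finset.in_setU => /orP[|]; [left|rewrite inE => /andP[_ /eqP]; right].
Qed.

Lemma reach_support i q : C i q -> dot (y i) q <= s i.
Proof.
move=> Cq; have [rep no] := reach_rep Hr.
have [/rep[a [a0 aH -> ->]]|/no[-> ->]] := boolP (i \in U); last exact: Hy0.
rewrite dot_suml; apply: ler_sum => r _; rewrite dotZl.
have [->|/aH ar] := eqVneq (a r) 0; first by rewrite !mul0r.
rewrite ler_wpM2l// dotC; move/CsetP: Cq; apply.
exact: (fintype.subsetP Hok).
Qed.

(** Projecting onto the cone [Cset'] makes [z - x] a combination of normals with zero constant that
    are tight at [x], so the new certificate is 0. Projecting onto [C i] makes [x] feasible, which
    the old certificates require. *)
Lemma dykstra_reach i z x : z = residual d y + y i ->
  is_proj (C i) z x -> is_proj (Cset' dot f c i) z x ->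
  let y' := fun j => if j == i then z - x else y j in
  exists s' H', [/\ reach dot f cr d y0 y' s' (U :|: [set i])%SET H', H \subset H',
    H' \subset ok, is_rep0 H' i (z - x) & residual d y' = x].
Proof.
move=> zE [Cx _] [Cx' xmin] y'.
have y'x : residual d y' = x.
  have zE' : z = d - \sum_(j | j != i) y j.
    by rewrite zE /residual (bigD1 i)//= opprD addrA addrAC subrK.
  rewrite /residual (bigD1 i)//= /y' eqxx.
  rewrite (eq_bigr y); last by move=> j /negbTE->.
  by rewrite zE' addrAC subrK subKr.
pose S := [set r : 'I_K | ((i, r) \in ok) && (fine (c i r) == 0)]%SET.
have CS q : Cset' dot f c i q <-> forall r, r \in S -> dot q (f i r) <= 0.
  split=> [Cq r|Cq r].
    rewrite inE => /andP[rok /eqP cr0].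
    have /halfspaceP/(_ rok) : halfspace dot f c i r q.
      by apply: Cq; apply/hyperplane0.
    by rewrite cr0.
  move=> /= /hyperplane0[rok cr0]; apply/halfspaceP => _; rewrite cr0.
  by apply: Cq; rewrite inE rok cr0 /=.
have [||a [a0 za aS]] := normal_cone_proj hdot (S := S) (g := f i) (b := fun=> 0)
  (x := x) (z := z).
- exact/CS.
- by move=> q /CS; exact: xmin.
have aP r : a r != 0 -> [/\ (i, r) \in tight x, fine (c i r) = 0 & dot x (f i r) = 0].
  move=> /aS[]; rewrite inE => /andP[rok /eqP cr0] xf; split=> //.
  by rewrite finset.in_setU [in X in _ || X]inE rok xf cr0 eqxx orbT.
have zx : dot (z - x) x = 0.
  rewrite za dot_suml big1// => r _; rewrite dotZl dotC.
  by have [->|/aP[_ _ ->]] := eqVneq (a r) 0; rewrite ?mul0r ?mulr0.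
have rep0 : is_rep0 (tight x) i (z - x) by exists a; split=> // r /aP[].
exists (fun j => if j == i then 0 else s j), (tight x).
split=> //; first last.
- exact: tight_ok.
- exact: finset.subsetUl.
apply: (reach_step Hr) => /=.
- by move=> j; rewrite finset.in_set1 /y' => /negbTE ->.
- move=> j; rewrite finset.in_set1 => /eqP->; rewrite /y' eqxx -/y' y'x zx; split=> //.
    exact: reach_support.
  exists a; split=> // [r /aP[]//|].
  by rewrite big1// => r _; have [->|/aP[_ -> _]] := eqVneq (a r) 0; rewrite ?mul0r ?mulr0.
(* First visit: [y0 i] is maximized over [C i] at 0, so complementary slackness at 0 leaves only
   zero constants. *)
- move=> j; rewrite finset.in_set1 => /eqP-> iU.
  have [_ /(_ i iU)[-> _]] := reach_rep Hr.
  have [||b [b0 yb bS]] := normal_cone_max hdot (S := [set r | (i, r) \in ok]%SET) (g := f i)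
    (b := fun r => fine (c i r)) (x := 0) (y := y0 i).
  + by move=> r _; rewrite dot0l fine_c0.
  + move=> q Hq; rewrite dot0r; apply: Hy0; apply/CsetP => r rok.
    by apply: Hq; rewrite inE.
  exists b; split=> // r /bS[]; rewrite inE dot0l => rok /esym cr0; split=> //.
  by rewrite y'x; move/CsetP: Cx => /(_ r rok); rewrite cr0.
- exact: finset.subsetUl.
- by move=> k; rewrite y'x; exact: tight_cases.
Qed.

(** Optimality gives multipliers for the halfspaces and cuts defining [P i]; each cut is then
    expanded into its recorded normals. [T] is finite because multipliers need finitely many
    constraints. *)
Lemma shqp_reach (T : finType) (E : T -> X) (Q : {set 'I_m}) (P : 'I_m -> set X)
    (y' : 'I_m -> X) :
  (forall i, i \notin Q -> y' i = y i) ->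
  (forall yt, (shqp_obj dot d Q P y y' <= shqp_obj dot d Q P y yt)%E) ->
  (forall i, i \in Q -> C i `<=` P i /\
     support_fun dot (y i) (P i) = support_fun dot (y i) (C i)) ->
  (forall i, i \in Q -> exists (A : set 'I_K) (B : set T),
     (forall t, B t -> i \in U /\ is_rep0 H i (E t)) /\
     P i = (\bigcap_(r in A) halfspace dot f c i r) `&`
           (\bigcap_(t in B) [set x | dot (E t) x <= 0])) ->
  exists s' H', [/\ reach dot f cr d y0 y' s' (U :|: Q)%SET H', H \subset H' & H' \subset ok].
Proof.
move=> out opt CP PAB; set x := residual d y'.
have yP i q : i \in Q -> P i q -> dot (y i) q <= s i.
  move=> iQ; move: q; apply/support_fun_leP; have [_ ->] := CP i iQ.
  by apply/support_fun_leP => q; exact: reach_support.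
pose g i (k : 'I_K + T) := match k with inl r => f i r | inr t => E t end.
pose b i (k : 'I_K + T) := match k with inl r => fine (c i r) | inr t => 0 end.
have PS i : i \in Q -> exists S : {set 'I_K + T}, [/\
    P i = [set q | forall k, k \in S -> dot q (g i k) <= b i k],
    forall r, inl r \in S -> (i, r) \in ok &
    forall t, inr t \in S -> i \in U /\ is_rep0 H i (E t)].
  move=> iQ; have [A [B [BP PE]]] := PAB i iQ.
  exists [set k | match k with
    | inl r => ((i, r) \in ok) && `[< A r >]
    | inr t => `[< B t >]
    end]%SET.
  split; last 2 first.
  - by move=> r; rewrite inE => /andP[].
  - by move=> t; rewrite inE => /asboolP/BP.
  rewrite PE; apply/seteqP; split=> q /=.
    move=> [HA HB] [r|t]; rewrite inE.
      by move=> /andP[rok /asboolP/HA/halfspaceP]; apply.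
    by move=> /asboolP/HB /=; rewrite dotC.
  move=> Hq; split=> [r Ar|t Bt].
    by apply/halfspaceP => rok; apply: (Hq (inl r)); rewrite inE rok; apply/asboolP.
  by rewrite /= dotC; apply: (Hq (inr t)); rewrite inE; apply/asboolP.
have P0 i : i \in Q -> P i 0 by move=> iQ; have [+ _] := CP i iQ; apply; exact: C0.
have fin i : i \in Q -> exists v : R, (support_fun dot (y i) (P i) <= v%:E)%E.
  by move=> iQ; exists (s i); apply/support_fun_leP => q; exact: yP.
have xopt i : i \in Q -> P i x /\ forall q, P i q -> dot (y' i) q <= dot (y' i) x.
  move=> iQ; have [S [PE _ _]] := PS i iQ.
  exact: (shqp_optimality hdot out opt P0 fin iQ PE).
exists (fun i => if i \in Q then dot (y' i) x else s i), (tight x).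
split; [|exact: finset.subsetUl|exact: tight_ok].
apply: (reach_step Hr) => [i iQ|i iQ|i iQ iU||k] /=.
- by rewrite out// (negbTE iQ).
- rewrite iQ; have [Px xmax] := xopt i iQ; split=> //; first exact: yP.
  have [S [PE SA SB]] := PS i iQ.
  have [||a [a0 ya aS]] := normal_cone_max hdot (S := S) (g := g i) (b := b i)
    (x := x) (y := y' i).
  + by move: Px; rewrite PE.
  + by move=> q Hq; apply: xmax; rewrite PE.
  have /choice[w Hw] : forall t, exists w : 'I_K -> R, a (inr t) != 0 ->
      [/\ forall r, 0 <= w r, forall r, w r != 0 -> (i, r) \in H /\ fine (c i r) = 0 &
      E t = \sum_r w r *: f i r].
    move=> t; have [_|at0] := eqVneq (a (inr t)) 0; first by exists (fun=> 0).
    have [tS _] := aS _ at0.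
    by have [_ [w Hw]] := SB t tS; exists w.
  (* The weight of [f i r] after the expansion. It can be nonzero only if the constraint is tight at
     [x] or comes from a cut and is already in [H]. *)
  pose e r := a (inl r) + \sum_t a (inr t) * w t r.
  have aw t r : 0 <= a (inr t) * w t r.
    have [->|at0] := eqVneq (a (inr t)) 0; first by rewrite mul0r.
    by rewrite mulr_ge0//; have [] := Hw t at0.
  have yE : y' i = \sum_r e r *: f i r.
    rewrite ya big_sumType /=.
    under [RHS]eq_bigr do rewrite scalerDl scaler_suml.
    rewrite big_split /=; congr (_ + _); rewrite exchange_big /=.
    apply: eq_bigr => t _; have [->|at0] := eqVneq (a (inr t)) 0.
      by rewrite scale0r big1// => r _; rewrite mul0r scale0r.
    have [_ _ ->] := Hw t at0; rewrite scaler_sumr.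
    by apply: eq_bigr => r _; rewrite scalerA.
  exists e; split=> //.
  + by move=> r; rewrite addr_ge0// sumr_ge0.
  + move=> r er; rewrite finset.in_setU.
    have [al|al] := eqVneq (a (inl r)) 0; last first.
      have [/SA rok xf] := aS _ al; rewrite /= in xf.
      by rewrite [in X in _ || X]inE rok xf eqxx orbT.
    move: er; rewrite /e al add0r => er.
    have [t tn] : exists t, a (inr t) * w t r != 0.
      apply: contrapT => /forallNP no; move: er; rewrite big1 ?eqxx// => t _.
      by apply/eqP; apply/negPn/negP; exact: no.
    have : (a (inr t) != 0) && (w t r != 0) by rewrite -negb_or -mulf_eq0.
    by move=> /andP[at0 wr]; have [_ /(_ r wr)[-> _] _] := Hw t at0.
  + rewrite {1}ya dot_suml big_sumType /=.
    rewrite [X in _ + X]big1 ?addr0 => [|t _]; last first.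
      have [->|/aS[_ /= tx]] := eqVneq (a (inr t)) 0; first by rewrite dotZl mul0r.
      by rewrite dotZl dotC tx mulr0.
    apply: eq_bigr => r _; rewrite dotZl /e mulrDl.
    rewrite [X in _ + X]mulr_suml [X in _ + X]big1 ?addr0 => [|t _].
      have [->|/aS[_ /= tx]] := eqVneq (a (inl r)) 0; first by rewrite !mul0r.
      by rewrite dotC tx.
    have [->|at0] := eqVneq (a (inr t)) 0; first by rewrite !mul0r.
    have [_ wP _] := Hw t at0.
    by have [->|/wP[_ ->]] := eqVneq (w t r) 0; rewrite ?mulr0 ?mul0r.
(* First modification: cuts exist only for blocks in [U], so the multipliers at 0 involve original
   halfspaces alone. *)
- have [S [PE SA SB]] := PS i iQ.
  have [_ /(_ i iU)[yi si]] := reach_rep Hr.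
  have [||a [a0 ya aS]] := normal_cone_max hdot (S := S) (g := g i) (b := b i)
    (x := 0) (y := y i).
  + by move=> [r|t] _; rewrite dot0l //= fine_c0.
  + by move=> q Hq; rewrite dot0r -si; apply: yP => //; rewrite PE.
  exists (fun r => a (inl r)); split=> //.
    rewrite ya big_sumType /= [X in _ + X]big1 ?addr0// => t _.
    have [->|/aS[/SB[]]] := eqVneq (a (inr t)) 0; first by rewrite scale0r.
    by rewrite (negbTE iU).
  move=> r /aS[rS]; rewrite dot0l /= => /esym cr0; split=> //.
  have [Px _] := xopt i iQ; move: Px; rewrite PE => /(_ _ rS) /=.
  by rewrite cr0.
- exact: finset.subsetUl.
- exact: tight_cases.
Qed.

End Step.
End Steps.

(** * A whole cycle as a block descent *)

Section Cycles.
Context (R : realType) (X : completeNormedModType R) (dot : {dot X for idfun}).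
Hypothesis hdot : forall x : X, dot x x = `|x| ^+ 2.
Context (m K : nat) (f : 'I_m -> 'I_K -> X) (c : 'I_m -> 'I_K -> \bar R) (d : X).
Hypothesis hc : forall i r, c i r != -oo%E.
Hypothesis c0 : forall i r, (0 <= c i r)%E.
Local Notation cr := (fun i r => fine (c i r)).
Local Notation ok := (finite_pairs c).

(** Induction on the visits. The invariant also records [is_rep0] for all past [e j' j'], because
    later polyhedra may use them as cuts. *)
Lemma cycle_reach (y0 : 'I_m -> X) (g : cycle X m) :
  is_cycle dot (Cset dot f c) d y0 g ->
  (forall i, support_fun dot (y0 i) (Cset dot f c i) = 0%E) ->
  (forall j : nat, (1 <= j <= cyc_w g)%N ->
    is_proj (Cset' dot f c (cyc_s g j)) (cyc_z g j) (cyc_xo g j)) ->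
  (forall (j : nat) (i : 'I_m), (1 <= j <= cyc_w g)%N -> i \in cyc_Q g j ->
     exists (A : set 'I_K) (B : set nat),
       (forall j', B j' -> (1 <= j' < j)%N /\ cyc_s g j' = i) /\
       cyc_P g i j =
         (\bigcap_(r in A) halfspace dot f c i r) `&`
         (\bigcap_(j' in B) [set x | dot (cyc_e g j' j') x <= 0])) ->
  exists y s H, [/\ reach dot f cr d y0 y s [set: 'I_m]%SET H, H \subset ok &
    residual d y = cyc_xp g (cyc_w g)].
Proof.
case: g => w s e z xo xp Q P yp /=.
move=> [[_ s0 visits] [e0 xp0] steps _] Hy0 proj shape.
have Hy0' i q : Cset dot f c i q -> dot (y0 i) q <= 0.
  by move: q; apply/support_fun_leP; rewrite Hy0.
pose st j := fun i => e (last_visit s j i) j.+1.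
have main (j : nat) : (j <= w)%N -> exists sg U H,
    [/\ reach dot f cr d y0 (st j) sg U H, H \subset ok, residual d (st j) = xp j &
     forall j' : nat, (1 <= j' <= j)%N -> s j' \in U /\ is_rep0 f c H (s j') (e j' j')].
  elim: j => [_|j IH jw].
    exists (fun=> 0), finset.set0, finset.set0.
    have -> : st 0%N = y0.
      by apply/funext => i; rewrite /st last_visit0// e0.
    split=> //; [exact: reach_init|exact: finset.sub0set|].
    by move=> j'; case: j'.
  have [sg [U [H [Hr Hok resj hist]]]] := IH (ltnW jw).
  have jP : (1 <= j.+1 <= w)%N by [].
  have [[zE pC eE] [QP out opt xpE]] := steps j.+1 jP.
  have pC' := proj j.+1 jP.
  have zE' : z j.+1 = residual d (st j) + st j (s j.+1) by rewrite resj.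
  have := dykstra_reach hdot hc c0 Hr Hok Hy0' zE' pC pC'.
  set y1 := fun i => _ => -[sg1 [H1 [Hr1 HH1 H1ok rep1 res1]]].
  (* [y1] is the state between the Dykstra step and the SHQP step of visit [j.+1]. *)
  have y1E : y1 = fun i => e (last_visit s j.+1 i) j.+1.
    apply/funext => i; rewrite /y1 last_visitS eq_sym; case: eqP => [_|_//].
    by rewrite eE.
  have hist1 (j' : nat) : (1 <= j' < j.+2)%N ->
      s j' \in (U :|: [set s j.+1])%SET /\ is_rep0 f c H1 (s j') (e j' j').
    move=> /andP[j1]; rewrite ltnS leq_eqVlt => /orP[/eqP->|j'j].
      by rewrite finset.in_setU finset.in_set1 eqxx orbT eE.
    have [|sU rep] := hist j'; first by rewrite j1.
    by rewrite finset.in_setU sU; split=> //; exact: is_rep0_sub rep.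
  have opt1 yt : (shqp_obj dot d (Q j.+1) (P ^~ j.+1) y1 (st j.+1) <=
      shqp_obj dot d (Q j.+1) (P ^~ j.+1) y1 yt)%E by rewrite y1E; exact: opt.
  (* Ordinals below [j.+2] index the cuts; 0 is not a visit and is excluded by [B]. *)
  have [||i iQ|sg2 [H2 [Hr2 HH2 H2ok]]] := @shqp_reach _ _ _ hdot _ _ _ _ _ hc c0
    _ _ _ _ _ Hr1 H1ok Hy0' 'I_j.+2 (fun t => e t t) _ _ _ _ opt1.
  - by move=> i iQ; rewrite y1E; exact: out.
  - by move=> i iQ; rewrite y1E; have [] := QP i iQ.
  - have [A [B [BP PE]]] := shape j.+1 i jP iQ.
    exists A, [set t : 'I_j.+2 | B t]; split.
      move=> t /= /BP[/andP[t1 tj] st']; rewrite -{1 2}st'; apply: hist1.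
      by rewrite t1 (ltn_trans tj).
    rewrite PE; congr (_ `&` _); apply/seteqP; split=> q Hq.
      by move=> t /= Bt; exact: (Hq t).
    move=> j' Bj'; have [/andP[_ j'j] _] := BP _ Bj'.
    by apply: (Hq (Ordinal (ltn_trans j'j (ltnSn _)))).
  exists sg2, (U :|: [set s j.+1] :|: Q j.+1)%SET, H2; split=> //.
  move=> j' j'P; have [sU rep] := hist1 j' j'P.
  by rewrite finset.in_setU sU; split=> //; exact: is_rep0_sub rep.
have [sg [U [H [Hr Hok res hist]]]] := main w (leqnn w).
exists (st w), sg, H; split=> //.
suff <- : U = [set: 'I_m]%SET by [].
apply/finset.setP => i; rewrite finset.in_setT; have [j [jw <-]] := visits i.
by have [] := hist j jw.
Qed.

End Cycles.

Theorem theorem6p10 (R : realType) (X : completeNormedModType R)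
  (dot : {dot X for idfun})
  (hdot : forall x : X, dot x x = `|x| ^+ 2)
  (m K : nat) (f : 'I_m -> 'I_K -> X) (c : 'I_m -> 'I_K -> \bar R)
  (hf : forall i r, `|f i r| = 1)
  (hc : forall i r, c i r != -oo%E)
  (hC : Cinter dot f c !=set0)
  (d : X) (hd : is_proj (Cinter dot f c) d 0)
  (K' : nat) (hK'K : (K' <= K)%N)
  (hK' : forall i r, i \notin Iset dot f c ->
     (hyperplane dot f c i r 0 <-> (r < K')%N))
  (eps_bar eps_hat : R)
  (hbar : is_eps_bar dot f c d eps_bar)
  (hhat : is_eps_hat dot f c d K' eps_hat) :
  exists rho : R, 0 <= rho < 1 /\
    forall (y0 : 'I_m -> X) (g : cycle X m),
      is_cycle dot (Cset dot f c) d y0 g ->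
      `|cyc_xp g 0%N| <= Num.min eps_hat (Num.sqrt (2 * eps_bar)) ->
      (forall i, support_fun dot (y0 i) (Cset dot f c i) = 0%E) ->
      (forall (j : nat) (i : 'I_m), (1 <= j <= cyc_w g)%N -> i \in cyc_Q g j ->
         exists (A : set 'I_K) (B : set nat),
           (forall j', B j' -> (1 <= j' < j)%N /\ cyc_s g j' = i) /\
           cyc_P g i j =
             (\bigcap_(r in A) halfspace dot f c i r) `&`
             (\bigcap_(j' in B) [set x | dot (cyc_e g j' j') x <= 0])) ->
      `|cyc_xp g (cyc_w g)| <= rho * `|cyc_xp g 0%N|.
Proof.
have c0 i r : (0 <= c i r)%E.
  by have := hd.1 i I r I; rewrite /halfspace /= dot0l.
(* A constraint with 0 on its boundary fails at small positive multiples of its normal, so 0 is not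
   interior. *)
have notI i r : hyperplane dot f c i r 0 -> i \notin Iset dot f c.
  rewrite /hyperplane /= dot0l => cir; apply/negP; rewrite inE => /asboolP.
  move=> /nbhs_ballP[e /= e0 be].
  have : Cset dot f c i ((e / 2) *: f i r).
    apply: be; rewrite -ball_normE /= sub0r normrN normrZ hf mulr1 gtr0_norm ?divr_gt0//.
    by rewrite ltr_pdivrMr// ltr_pMr// ltr1n.
  move=> /(_ r I); rewrite /halfspace /= -cir lee_fin dotZl hdot hf expr1n mulr1.
  by rewrite leNgt divr_gt0.
have [eh0 hat] := hhat.
(* Every finite pair with zero constant has [i \notin Iset] and [r < K'], so the double sum in
   [is_eps_hat] is the sum over all pairs. *)
have hat' (a : 'I_m * 'I_K -> R) : (forall k, 0 <= a k) ->
    (forall k, a k != 0 -> k \in finite_pairs c /\ fine (c k.1 k.2) = 0) ->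
    `|d - \sum_k a k *: f k.1 k.2| <= eps_hat ->
    in_span [set k | 0 < a k] (fun k => f k.1 k.2) d.
  move=> a0 aP le.
  have aH i r : a (i, r) != 0 -> (i \notin Iset dot f c) && (r < K')%N.
    move=> /aP/(hyperplane0 dot f) h0; have iI := notI _ _ h0.
    by rewrite iI /=; apply/(hK' _ _ iI).
  have sE : \sum_(i | i \notin Iset dot f c) \sum_(r < K | (r < K')%N) a (i, r) *: f i r
      = \sum_k a k *: f k.1 k.2.
    pose inK' (k : 'I_m * 'I_K) := (k.1 \notin Iset dot f c) && (k.2 < K')%N.
    rewrite pair_big_dep /= [RHS](bigID inK') /=.
    rewrite [X in _ = _ + X]big1 ?addr0 => [|k]; last first.
      apply: contraNeq; rewrite scaler_eq0 negb_or => /andP[ak _]; apply: aH.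
      by rewrite -surjective_pairing.
    by apply: eq_bigr => -[].
  have [|_ [b [b0 db]]] := hat (fun i r => a (i, r)) (fun i r _ _ => a0 (i, r)).
    by rewrite sE.
  exists b; split=> // k nk; apply: b0 => -[_ _ /=]; rewrite -surjective_pairing.
  exact: nk.
have [rho [rho01 contr]] := reach_contraction hdot hf eh0
  (fun i r => fine_c0 c0 i r) hat'.
exists rho; split=> // y0 g gc x0 Hy0 shape.
have x0E : residual d y0 = cyc_xp g 0%N.
  by case: g gc {x0 shape} => w s e z xo xp Q P yp /= [_ [_ ->]].
have proj (j : nat) : (1 <= j <= cyc_w g)%N ->
    is_proj (Cset' dot f c (cyc_s g j)) (cyc_z g j) (cyc_xo g j).
  have [eb0 bar] := hbar; move=> /(bar y0 g gc)[]//.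
  (* The supports vanish, so the dual value is half the squared norm of the initial residual, hence
     at most [eps_bar]. *)
  rewrite /dualv [X in (_ + X)%E]big1 ?adde0 => [|i _]; last exact: Hy0.
  rewrite lee_fin ler_pdivrMl// -[leLHS]/(`|residual d y0| ^+ 2) x0E.
  rewrite -[leRHS]sqr_sqrtr ?mulr_ge0 ?(ltW eb0)// lerXn2r ?nnegrE ?sqrtr_ge0//.
  by apply: le_trans x0 _; rewrite ge_min lexx orbT.
have [y [s [H [Hr Hok <-]]]] := cycle_reach hdot hc c0 gc Hy0 proj shape.
rewrite -x0E; apply: contr Hr Hok _; rewrite x0E.
by apply: le_trans x0 _; rewrite ge_min lexx.
Qed.
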